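(* Let $\overline{X}=(X_0,X_1)$ be a compatible (quasi-)Banach couple and let $0<\theta_0<\theta_1<1$. Let $E_0,E_1,F_0,F_1$ be r.i. spaces and let $a_0,a_1,b_0,b_1\in SV$ be such that $\|b_0\|_{\widetilde{E}_0(0,1)}<\infty$ and $\|b_1\|_{\widetilde{E}_1(1,\infty)}<\infty$. Put $$\rho(u)=u^{\theta_1-\theta_0}\frac{a_0(u)\|b_0\|_{\widetilde{E}_0(0,u)}}{a_1(u)\|b_1\|_{\widetilde{E}_1(u,\infty)}},\qquad u>0.$$ Then, for every $f\in\overline{X}^{\mathcal R}_{\theta_0,b_0,E_0,a_0,F_0}+\overline{X}^{\mathcal L}_{\theta_1,b_1,E_1,a_1,F_1}$ and every $u>0$, $$\begin{aligned}K\big(\rho(u),f;\overline{X}^{\mathcal R}_{\theta_0,b_0,E_0,a_0,F_0},\overline{X}^{\mathcal L}_{\theta_1,b_1,E_1,a_1,F_1}\big)\sim{}&\Big\|b_0(t)\|s^{-\theta_0}a_0(s)K(s,f)\|_{\widetilde{F}_0(t,u)}\Big\|_{\widetilde{E}_0(0,u)}\\&+\rho(u)\Big\|b_1(t)\|s^{-\theta_1}a_1(s)K(s,f)\|_{\widetilde{F}_1(u,t)}\Big\|_{\widetilde{E}_1(u,\infty)},\end{aligned}$$ with equivalence constants independent of $f$ and $u$.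
   Context: R.i. spaces: an ''r.i. space'' $E$ is a rearrangement invariant Banach function space on $(0,\infty)$ (Lebesgue measure) with the Fatou property. $\widetilde{E}$ denotes the corresponding r.i. space with respect to the measure $dt/t$ on $(0,\infty)$: if $E=\mathcal F(L_1,L_\infty)$ for an interpolation functor $\mathcal F$, then $\widetilde{E}=\mathcal F(\widetilde L_1,L_\infty)$ with $\widetilde L_1=L_1((0,\infty),dt/t)$; concretely $\|f\|_{\widetilde E}=\|f^\star\|_E$, where $f^\star$ is the non-increasing rearrangement of $f$ with respect to $dt/t$. For an interval $I\subset(0,\infty)$, $\|f\|_{\widetilde E(I)}=\|f\chi_I\|_{\widetilde E}$. Slowly varying functions: a positive (finite) measurable function $b$ on $(0,\infty)$ belongs to $SV$ if for every $\varepsilon>0$, $t^{\varepsilon}b(t)$ is equivalent to a non-decreasing function and $t^{-\varepsilon}b(t)$ is equivalent to a non-increasing function on $(0,\infty)$. For a compatible (quasi-)Banach couple $(Y_0,Y_1)$, $K(t,f;Y_0,Y_1)=\inf\{\|f_0\|_{Y_0}+t\|f_1\|_{Y_1}: f=f_0+f_1,\ f_i\in Y_i\}$; write $K(t,f)=K(t,f;X_0,X_1)$. The space $\overline X^{\mathcal R}_{\theta,b,E,a,F}$ (resp. $\overline X^{\mathcal L}_{\theta,b,E,a,F}$) consists of all $f\in X_0+X_1$ with finite (quasi-)norm $\big\|b(t)\|s^{-\theta}a(s)K(s,f)\|_{\widetilde F(t,\infty)}\big\|_{\widetilde E}$ (resp. $\big\|b(t)\|s^{-\theta}a(s)K(s,f)\|_{\widetilde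 F(0,t)}\big\|_{\widetilde E}$). In nested norms the inner norm is taken in $s$ and the outer one in $t$. $A\sim B$ means $A\le cB$ and $B\le cA$ for some constant $c>0$. *)

(* Defs.v *)
From HB Require Import structures.
From mathcomp Require Import all_boot all_order all_algebra.
From mathcomp Require Import all_classical all_reals all_analysis measurable_realfun.

Set Implicit Arguments.
Unset Strict Implicit.
Unset Printing Implicit Defensive.

Import Order.TTheory GRing.Theory Num.Theory.
Import numFieldNormedType.Exports.

Local Open Scope classical_set_scope.
Local Open Scope ring_scope.
Local Open Scope ereal_scope.

Definition pos_line (R : realType) : set R := `]0%R, +oo[%classic.

Definition equiv_with (R : realType) (c : R) (A B : \bar R) : Prop :=
  A <= c%:E * B /\ B <= c%:E * A.

(* The type of (candidate) function norms on (0, oo): such a norm is only meant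
   to be evaluated at functions in [nonneg_meas] below, as in
   Bennett-Sharpley; their values outside (0, oo) are irrelevant. *)
Definition fnorm (R : realType) := (R -> \bar R) -> \bar R.

Definition nonneg_meas (R : realType) (f : R -> \bar R) : Prop :=
  measurable_fun (@pos_line R) f /\ forall x : R, pos_line x -> 0 <= f x.

Definition distrib (R : realType) (m : set R -> \bar R) (f : R -> \bar R)
    (y : R) : \bar R :=
  m [set x | pos_line x /\ y%:E < `|f x|].

(* Infimum over an empty set of levels is +oo. *)
Definition rearrangement (R : realType) (m : set R -> \bar R)
    (f : R -> \bar R) (t : R) : \bar R :=
  ereal_inf [set y%:E | y in [set y : R | (0 <= y)%R /\ distrib m f y <= t%:E]].

(* Rearrangement invariant Banach function norm on (0, oo) with Lebesgue
   measure (Bennett-Sharpley, Definitions I.1.1 and II.4.1); [ri_fatou] is the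
   Fatou property. *)
Record ri_space (R : realType) (E : fnorm R) : Prop := RiSpace {
  ri_ge0 : forall f, nonneg_meas f -> 0 <= E f ;
  ri_eq0 : forall f, nonneg_meas f ->
    (E f = 0 <-> {ae @lebesgue_measure R, forall x, pos_line x -> f x = 0}) ;
  ri_homo : forall (a : R) f, (0 <= a)%R -> nonneg_meas f ->
    E (fun x => a%:E * f x) = a%:E * E f ;
  ri_triangle : forall f g, nonneg_meas f -> nonneg_meas g ->
    E (fun x => f x + g x) <= E f + E g ;
  ri_mono : forall f g, nonneg_meas f -> nonneg_meas g ->
    {ae @lebesgue_measure R, forall x, pos_line x -> g x <= f x} ->
    E g <= E f ;
  ri_fatou : forall (f_ : nat -> R -> \bar R) f,
    (forall n, nonneg_meas (f_ n)) -> nonneg_meas f ->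
    {ae @lebesgue_measure R, forall x, pos_line x ->
      (forall n, f_ n x <= f_ n.+1 x) /\ f_ ^~ x @ \oo --> f x} ->
    (fun n => E (f_ n)) @ \oo --> E f ;
  ri_finite : forall A : set R, measurable A -> A `<=` @pos_line R ->
    lebesgue_measure A < +oo -> E (EFin \o \1_A) < +oo ;
  ri_integral : forall A : set R, measurable A -> A `<=` @pos_line R ->
    lebesgue_measure A < +oo ->
    exists2 C : R, (0 < C)%R & forall f, nonneg_meas f ->
      \int[@lebesgue_measure R]_(x in A) f x <= C%:E * E f ;
  ri_invariant : forall f g, nonneg_meas f -> nonneg_meas g ->
    (forall y : R, (0 <= y)%R ->
      distrib (@lebesgue_measure R) f y = distrib (@lebesgue_measure R) g y) ->
    E f = E g
}.

(* The measure dt/t on (0, oo). *)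
Definition dtt (R : realType) (A : set R) : \bar R :=
  \int[@lebesgue_measure R]_(x in A `&` @pos_line R) (x^-1)%:E.

(* [tnorm E I f] is the norm of f in E~(I). *)
Definition tnorm (R : realType) (E : fnorm R) (I : set R) (f : R -> \bar R) :
    \bar R :=
  E (rearrangement (@dtt R) (f \_ I)).

Record slowly_varying (R : realType) (b : R -> R) : Prop := SlowlyVarying {
  sv_measurable : measurable_fun (@pos_line R) b ;
  sv_gt0 : forall t : R, (0 < t)%R -> (0 < b t)%R ;
  sv_incr : forall e : R, (0 < e)%R -> exists (g : R -> R) (c : R),
    [/\ (0 < c)%R,
        forall s t : R, (0 < s)%R -> (s <= t)%R -> (g s <= g t)%R &
        forall t : R, (0 < t)%R -> equiv_with c (t `^ e * b t)%:E (g t)%:E] ;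
  sv_decr : forall e : R, (0 < e)%R -> exists (g : R -> R) (c : R),
    [/\ (0 < c)%R,
        forall s t : R, (0 < s)%R -> (s <= t)%R -> (g t <= g s)%R &
        forall t : R, (0 < t)%R -> equiv_with c (t `^ (- e) * b t)%:E (g t)%:E]
}.

(* A (quasi-)normed space whose elements lie in an ambient space V; the value of
   [qnorm] outside [carrier] is irrelevant. *)
Record qspace (R : realType) (V : Type) := QSpace {
  carrier : set V ;
  qnorm : V -> \bar R
}.

(* Quasi-Banach space (Banach when [qb_triangle] holds with C = 1) embedded
   continuously in V; continuity of the inclusion is stated at 0, which suffices
   as it is linear. Scalars are real: complex spaces are covered by restricting
   scalars, as the K-functional only involves sums. *)
Record quasi_banach_in (R : realType) (V : topologicalLmodType R)
    (X : qspace R V) : Prop := QuasiBanachIn {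
  qb_0 : carrier X 0%R ;
  qb_D : forall x y, carrier X x -> carrier X y -> carrier X (x + y)%R ;
  qb_Z : forall (a : R) x, carrier X x -> carrier X (a *: x)%R ;
  qb_ge0 : forall x, carrier X x -> 0 <= qnorm X x ;
  qb_fin : forall x, carrier X x -> qnorm X x < +oo ;
  qb_eq0 : forall x, carrier X x -> qnorm X x = 0 -> x = 0%R ;
  qb_homo : forall (a : R) x, carrier X x ->
    qnorm X (a *: x)%R = `|a|%:E * qnorm X x ;
  qb_triangle : exists C : R, forall x y, carrier X x -> carrier X y ->
    qnorm X (x + y)%R <= C%:E * (qnorm X x + qnorm X y) ;
  qb_complete : forall x_ : nat -> V, (forall n, carrier X (x_ n)) ->
    (forall e : R, (0 < e)%R -> exists N, forall m n, (N <= m)%N -> (N <= n)%N ->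
      qnorm X (x_ m - x_ n)%R < e%:E) ->
    exists2 x, carrier X x &
      (fun n => qnorm X (x_ n - x)%R) @ \oo --> (0 : \bar R) ;
  qb_embed : forall U : set V, nbhs (0%R : V) U ->
    exists2 d : R, (0 < d)%R &
      forall x, carrier X x -> qnorm X x < d%:E -> U x
}.

(* The ambient space is any Hausdorff topological vector space, not necessarily
   locally convex. *)
Record compatible_couple (R : realType) (V : topologicalLmodType R)
    (X0 X1 : qspace R V) : Prop := CompatibleCouple {
  cc_hausdorff : hausdorff_space V ;
  cc_qb0 : quasi_banach_in X0 ;
  cc_qb1 : quasi_banach_in X1
}.

Definition sum_space (R : realType) (V : lmodType R) (Y0 Y1 : qspace R V) :
    set V :=
  [set f | exists f0 f1, [/\ carrier Y0 f0, carrier Y1 f1 & f = (f0 + f1)%R]].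

Definition Kfun (R : realType) (V : lmodType R) (Y0 Y1 : qspace R V) (t : R)
    (f : V) : \bar R :=
  ereal_inf [set z | exists f0 f1,
    [/\ carrier Y0 f0, carrier Y1 f1, f = (f0 + f1)%R &
        z = qnorm Y0 f0 + t%:E * qnorm Y1 f1]].

(* s^(-th) a(s) K(s, f; X0, X1) *)
Definition wK (R : realType) (V : lmodType R) (X0 X1 : qspace R V) (th : R)
    (a : R -> R) (f : V) (s : R) : \bar R :=
  (s `^ (- th) * a s)%:E * Kfun X0 X1 s f.

Definition XR_norm (R : realType) (V : lmodType R) (X0 X1 : qspace R V) (th : R)
    (b : R -> R) (E : fnorm R) (a : R -> R) (F : fnorm R) (f : V) : \bar R :=
  tnorm E (@pos_line R)
    (fun t => (b t)%:E * tnorm F `]t, +oo[%classic (wK X0 X1 th a f)).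

Definition XL_norm (R : realType) (V : lmodType R) (X0 X1 : qspace R V) (th : R)
    (b : R -> R) (E : fnorm R) (a : R -> R) (F : fnorm R) (f : V) : \bar R :=
  tnorm E (@pos_line R)
    (fun t => (b t)%:E * tnorm F `]0%R, t[%classic (wK X0 X1 th a f)).

Definition XR_space (R : realType) (V : lmodType R) (X0 X1 : qspace R V) (th : R)
    (b : R -> R) (E : fnorm R) (a : R -> R) (F : fnorm R) : qspace R V :=
  QSpace [set f | sum_space X0 X1 f /\ XR_norm X0 X1 th b E a F f < +oo]
         (XR_norm X0 X1 th b E a F).

Definition XL_space (R : realType) (V : lmodType R) (X0 X1 : qspace R V) (th : R)
    (b : R -> R) (E : fnorm R) (a : R -> R) (F : fnorm R) : qspace R V :=
  QSpace [set f | sum_space X0 X1 f /\ XL_norm X0 X1 th b E a F f < +oo]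
         (XL_norm X0 X1 th b E a F).

(* Both norms are finite and positive when the weights are slowly varying with
   ||b0||_{E0~(0,1)} and ||b1||_{E1~(1,oo)} finite, so [fine] and the division
   are harmless. *)
Definition rho (R : realType) (th0 th1 : R) (a0 a1 b0 b1 : R -> R)
    (E0 E1 : fnorm R) (u : R) : R :=
  (u `^ (th1 - th0) *
   ((a0 u * fine (tnorm E0 `]0, u[%classic (EFin \o b0))) /
    (a1 u * fine (tnorm E1 `]u, +oo[%classic (EFin \o b1)))))%R.

(* Main.v *)
Require Import Defs.
From HB Require Import structures.
From mathcomp Require Import all_boot all_order all_algebra.
From mathcomp Require Import all_classical all_reals all_analysis measurable_realfun.
From mathcomp Require Import lra ring.
Import Order.TTheory GRing.Theory Num.Theory.
Import numFieldNormedType.Exports.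
Local Open Scope classical_set_scope.
Local Open Scope ring_scope.
Local Open Scope ereal_scope.
Set Implicit Arguments.
Unset Strict Implicit.

(** The theorem is a Holmstedt formula, and its proof only looks at elements
of the couple through their K-functionals.

The norms over dt/t are tamed first. The rearrangement is not a linear
operation, but t = u e^x turns dt/t on (u, oo) into Lebesgue measure on
(0, oo), so that the norm of a function living on (u, oo) is the norm of its
composition with an exponential ([tnorm_exp]); truncating at 1/n and using the
Fatou property ([tnorm_cvg]) then gives the triangle inequality and
homogeneity of [tnorm] on every measurable set. The same substitution shows
that the norm of (s/u)^(-b) over (u, oo) does not depend on u and is finite,
and that the norm of 1 over (u, 2u) is a positive constant. Consequently, if a
weight w decays like a negative power, up to slowly varying factors, then its
norm over (u, oo) is at most a constant times w(u); dually for growing weights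
and (0, u).

Write w = s^(-th) a(s), K(s) = K(s, f), and B(u) for the norm of b over
(0, u). For the space of type R three facts suffice, all of them consequences
of the monotonicity of K(s) and K(s)/s. The truncated norm P(u) dominates
w(u) K(u) B(u), because the parts t < u/2 and u/2 < s < u alone contribute
that much ([tailtrunc_ge]). The full norm dominates w(u) K(u) B(u) at every u
([tailnorm_ge]). If a profile l is at most K on (0, u) and stays below K(u)
afterwards, then its full norm is at most a constant times P(u), since
everything beyond u is bounded by w(u) K(u) B(u) ([tailnorm_le_trunc]). The
space of type L reduces to type R by s -> 1/s, which replaces K(s) by
s K(1/s).

Upper estimate ([Kfun_le_truncated]): split f = f0 + f1 nearly optimally for
K(u, f). Then K(s, f0) is bounded by 2 K(u, f), K(s, f1) by 2 (s/u) K(u, f),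
and each of them by a constant times K(s, f) on its own side of u, so the full
norms of f0 and f1 are controlled by the two truncated norms of f.

Lower estimate ([truncated_le_Kfun]): for any f = f0 + f1 in the sum, the
truncated norms of f are bounded by those of f0 and f1. Two of these four
terms are at most full norms. The other two mix scales; there the pointwise
bound of K by the full norm is inserted, and the ratio of the two weights,
which behaves like a nonzero power because th0 < th1, is summed up to its
value at u ([tailtrunc_le_headnorm], [headtrunc_le_tailnorm]). The factor
rho(u) is exactly the constant that comes out. *)

(** * The measure dt/t *)

Section HaarMeasure.
Context {R : realType}.
Local Notation mu := (@lebesgue_measure R).

Lemma pos_lineE (x : R) : pos_line x = (0 < x)%R :> Prop.
Proof. by rewrite /pos_line /= in_itv/= andbT. Qed.

Lemma measurable_pos_line : measurable (@pos_line R).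
Proof. exact: measurable_itv. Qed.

Lemma measurable_funV_pos : measurable_fun (@pos_line R) (fun x => (x^-1)%:E).
Proof.
apply/measurable_EFinP; apply: open_continuous_measurable_fun => //.
by move=> x; rewrite inE pos_lineE => x0; apply: inv_continuous; rewrite gt_eqF.
Qed.

(** A nonnegative integral is a supremum over simple functions, so monotonicity
holds for arbitrary sets, and pointwise comparison of functions passes directly
to their rearrangements. *)
Lemma le_dtt (A B : set R) : A `<=` B -> dtt A <= dtt B.
Proof.
move=> AB; rewrite /dtt !ge0_integralE; last 2 first.
- by move=> x [_]; rewrite pos_lineE lee_fin invr_ge0 => /ltW.
- by move=> x [_]; rewrite pos_lineE lee_fin invr_ge0 => /ltW.
apply: ereal_sup_le => _ [h hf <-]; exists h => //.
move=> x; apply: (le_trans (hf x)); rewrite /patch.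
case: ifPn; last first.
  by case: ifPn => // /set_mem [_]; rewrite pos_lineE lee_fin invr_ge0 => /ltW.
move=> /set_mem[/AB Bx px]; rewrite ifT//; exact/mem_set.
Qed.

Lemma dtt_ge0 (A : set R) : 0 <= dtt A.
Proof.
by apply: integral_ge0 => x [_]; rewrite pos_lineE lee_fin invr_ge0 => /ltW.
Qed.

Lemma dtt_set0 : @dtt R set0 = 0.
Proof. by rewrite /dtt set0I integral_set0. Qed.

Lemma dtt_semi_sigma_additive :
  semi_sigma_additive (@dtt R : set (measurableTypeR R) -> \bar R).
Proof.
move=> F mF tF mUF; rewrite /dtt setI_bigcupl ge0_integral_bigcup//=.
- apply: is_cvg_ereal_nneg_natsum_cond => n _ _; exact: dtt_ge0.
- by move=> n; apply: measurableI => //; exact: measurable_pos_line.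
- by apply: measurable_funS measurable_funV_pos => //; [exact: measurable_pos_line|move=> x [n _ []]].
- by move=> x [n _ [_]]; rewrite pos_lineE lee_fin invr_ge0 => /ltW.
- exact: trivIset_setIr.
Qed.

HB.instance Definition _ := isMeasure.Build _ _ _
  (@dtt R : set (measurableTypeR R) -> \bar R)
  dtt_set0 dtt_ge0 dtt_semi_sigma_additive.

Lemma dtt_itvcc (a b : R) : (0 < a)%R -> (a < b)%R ->
  dtt `[a, b] = (ln b - ln a)%:E.
Proof.
move=> a0 ab; rewrite /dtt (_ : _ `&` _ = `[a, b]%classic); last first.
  apply/seteqP; split => [x []//|x /= xab]; split => //.
  by move: xab; rewrite pos_lineE in_itv/= => /andP[/(lt_le_trans a0)].
rewrite (@continuous_FTC2 _ _ (@ln R))//.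
- apply: continuous_in_subspaceT => x; rewrite inE/= in_itv/= => /andP[ax _].
  by apply: inv_continuous; rewrite gt_eqF// (lt_le_trans a0).
- split.
  + by move=> x; rewrite in_itv/= => /andP[ax _]; apply: ex_derive; apply: is_derive1_ln; exact: lt_trans ax.
  + by apply: cvg_at_right_filter; exact: continuous_ln.
  + by apply: cvg_at_left_filter; apply: continuous_ln; exact: lt_trans ab.
- move=> x; rewrite in_itv/= => /andP[ax _]; have x0 := lt_trans a0 ax.
  by rewrite derive1E; apply: derive_val; exact: is_derive1_ln.
Qed.

Lemma dtt_itv (x y : bool) (a b : R) : (0 < a)%R -> (a < b)%R ->
  dtt [set` Interval (BSide x a) (BSide y b)] = (ln b - ln a)%:E.
Proof.
move=> a0 ab; rewrite -dtt_itvcc//.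
have pos (x' y' : bool) : [set` Interval (BSide x' a) (BSide y' b)] `<=` @pos_line R.
  move=> z /=; rewrite pos_lineE itv_boundlr => /andP[az _].
  by apply: (lt_le_trans a0); move: az; case: x' => //= /ltW.
have mV (x' y' : bool) :
    measurable_fun [set` Interval (BSide x' a) (BSide y' b)] (fun x => (x^-1)%:E).
  by apply: measurable_funS measurable_funV_pos => //; exact: measurable_pos_line.
rewrite /dtt !setIidl//.
case: x; case: y => //.
- by rewrite integral_itv_bndo_bndc.
- by rewrite integral_itv_bndo_bndc ?integral_itv_obnd_cbnd.
- by rewrite integral_itv_obnd_cbnd.
Qed.
End HaarMeasure.

(** * Logarithmic coordinates *)

Section LogarithmicCoordinates.
Context {R : realType}.
Local Notation mu := (@lebesgue_measure R).

Lemma dttI_pos (A : set R) : dtt (A `&` @pos_line R) = dtt A.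
Proof. by rewrite /dtt -setIA setIid. Qed.

Lemma measurable_preimage_exp (u : R) (A : set R) : measurable A ->
  measurable [set x : R | A (u * expR x)%R].
Proof.
move=> mA; have mf : measurable_fun setT (fun x : R => (u * expR x)%R).
  by apply: measurable_funM => //; exact: measurable_expR.
by have := mf measurableT _ mA; rewrite setTI.
Qed.

(** The logarithm carries dt/t to dx, whatever the scale u. By uniqueness of
Lebesgue measure it is enough to compare both measures on intervals. *)
Lemma dtt_expR (u : R) (A : set R) : (0 < u)%R -> measurable A ->
  A `<=` @pos_line R -> mu [set x : R | A (u * expR x)%R] = dtt A.
Proof.
move=> u0 mA Apos.
pose lg : measurableTypeR R -> measurableTypeR R := fun s => ln (s / u).
have mlg : measurable_fun setT lg.
  by apply: (@measurableT_comp _ _ _ _ _ _ (@ln R)); [exact: measurable_ln|exact: mulrr_measurable].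
have -> : mu [set x | A (u * expR x)%R] =
    pushforward (@dtt R : set (measurableTypeR R) -> \bar R) lg
      [set x | A (u * expR x)%R].
  apply: lebesgue_measure_unique => //=; last exact: measurable_preimage_exp.
  move=> _ [[a b]] _ <-; rewrite lebesgue_measure_itv/= lte_fin /pushforward.
  rewrite -dttI_pos (_ : _ `&` _ = `]u * expR a, u * expR b]%classic)%R; last first.
    apply/seteqP; split => s /=.
      rewrite pos_lineE !in_itv/= /lg => -[/andP[al lb] s0].
      have su : (0 < s / u)%R by rewrite divr_gt0.
      rewrite !(mulrC u) -ltr_pdivlMr// -ler_pdivrMr//.
      by rewrite -(lnK (_ : (s / u)%R \is Num.pos)) ?posrE// ltr_expR ler_expR al lb.
    rewrite pos_lineE !in_itv/= /lg => /andP[al lb].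
    have s0 : (0 < s)%R by apply: lt_trans al; rewrite mulr_gt0 ?expR_gt0.
    have su : (0 < s / u)%R by rewrite divr_gt0.
    split => //; move: al lb.
    rewrite !(mulrC u) -ltr_pdivlMr// -ler_pdivrMr//.
    by rewrite -{1 2}(lnK (_ : (s / u)%R \is Num.pos)) ?posrE// ltr_expR ler_expR => -> ->.
  case: ltP => ab.
    rewrite dtt_itv ?mulr_gt0 ?expR_gt0//; last by rewrite ltr_pM2l// ltr_expR.
    by rewrite !lnM ?posrE ?expR_gt0// !expRK; congr EFin; lra.
  by rewrite set_itv_ge ?dtt_set0// bnd_simp -leNgt ler_pM2l// ler_expR.
rewrite /pushforward -dttI_pos -[RHS]dttI_pos; congr dtt.
apply/seteqP; split => s [/= As]; rewrite pos_lineE => s0; split => //=; move: As;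
  by rewrite /lg/= lnK ?posrE ?divr_gt0// mulrCA divff ?mulr1 ?gt_eqF.
Qed.

(** The decreasing parametrization, for functions living near 0. *)
Lemma dtt_expRN (u : R) (A : set R) : (0 < u)%R -> measurable A ->
  A `<=` @pos_line R -> mu [set x : R | A (u * expR (- x))%R] = dtt A.
Proof.
move=> u0 mA Apos; rewrite -(dtt_expR u0 mA Apos).
by rewrite -[RHS]lebesgue_measureN//; exact: measurable_preimage_exp.
Qed.
End LogarithmicCoordinates.

(** * Rearrangements *)

Section Rearrangement.
Context {R : realType}.
Local Notation mu := (@lebesgue_measure R).
Implicit Types (f g : R -> \bar R) (m : set R -> \bar R).

(** Rearrangements and inner norms over shrinking sets are monotone functions
of their parameter; their measurability always comes from this. *)
Lemma nonincreasing_nonneg_meas (h : R -> \bar R) :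
  (forall s t : R, (0 < s)%R -> (s <= t)%R -> h t <= h s) ->
  (forall t : R, (0 < t)%R -> 0 <= h t) -> nonneg_meas h.
Proof.
move=> hni h0; split; last by move=> x; rewrite pos_lineE; exact: h0.
move=> mD; apply: (measurability _ (ErealGenOInfty.measurableE R)) => //.
move=> _ [_ [r ->] <-]; apply: is_interval_measurable => x y /=.
rewrite !pos_lineE !in_itv/= !andbT => -[x0 rx] [y0 ry] z /andP[xz zy].
have z0 := lt_le_trans x0 xz; split; first by rewrite pos_lineE.
by rewrite in_itv/= andbT; apply: (lt_le_trans ry); exact: hni.
Qed.

Lemma nondecreasing_nonneg_meas (h : R -> \bar R) :
  (forall s t : R, (0 < s)%R -> (s <= t)%R -> h s <= h t) ->
  (forall t : R, (0 < t)%R -> 0 <= h t) -> nonneg_meas h.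
Proof.
move=> hnd h0; split; last by move=> x; rewrite pos_lineE; exact: h0.
move=> mD; apply: (measurability _ (ErealGenOInfty.measurableE R)) => //.
move=> _ [_ [r ->] <-]; apply: is_interval_measurable => x y /=.
rewrite !pos_lineE !in_itv/= !andbT => -[x0 rx] [y0 ry] z /andP[xz zy].
have z0 := lt_le_trans x0 xz; split; first by rewrite pos_lineE.
by rewrite in_itv/= andbT; apply: (lt_le_trans rx); exact: hnd.
Qed.

Lemma rearrangement_ge0 m f t : 0 <= rearrangement m f t.
Proof. by apply/ereal_infP => _ [y [y0 _] <-]; rewrite lee_fin. Qed.

Lemma nonneg_meas_rearrangement m f : nonneg_meas (rearrangement m f).
Proof.
apply: nonincreasing_nonneg_meas => [s t _ st|t _]; last exact: rearrangement_ge0.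
apply: ereal_inf_le_tmp => _ [y [y0 ys] <-]; exists y => //; split => //.
by apply: (le_trans ys); rewrite lee_fin.
Qed.

Lemma le_rearrangement m f g t :
  (forall y : R, (0 <= y)%R -> distrib m f y <= distrib m g y) ->
  rearrangement m f t <= rearrangement m g t.
Proof.
move=> fg; apply: ereal_inf_le_tmp => _ [y [y0 yt] <-]; exists y => //; split => //.
exact: le_trans (fg _ y0) yt.
Qed.

Lemma measurable_superlevel f (y : R) : nonneg_meas f ->
  measurable [set x | pos_line x /\ y%:E < `|f x|].
Proof.
move=> [mf _]; have mF := measurableT_comp (@abse_measurable R setT) mf.
have := mF measurable_pos_line `]y%:E, +oo[%classic (emeasurable_itv _).
by congr measurable; apply/seteqP; split => x /= [px]; rewrite in_itv/= andbT.
Qed.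

(** Continuity of dt/t from below along the levels y + 1/(n+1). *)
Lemma distrib_right_continuous f (t y : R) : nonneg_meas f -> t%:E < distrib (@dtt R) f y ->
  exists2 z : R, (y < z)%R & t%:E < distrib (@dtt R) f z.
Proof.
move=> mf ty.
pose F (n : nat) := [set x | pos_line x /\ (y + n.+1%:R^-1)%:E < `|f x|].
have mF n : measurable (F n) by exact: measurable_superlevel.
have FU : \bigcup_n F n = [set x | pos_line x /\ y%:E < `|f x|].
  apply/seteqP; split => [x [n _ [px]] /= fx|x /= [px yx]].
    by split => //; apply: lt_trans fx; rewrite lte_fin ltrDl.
  have [z yz zx] : exists2 z, (y < z)%R & z%:E <= `|f x|.
    move: yx; case: `|f x| => [r|//|//]; first by rewrite lte_fin => yr; exists r.
    by move=> _; exists (y + 1)%R; rewrite ?ltrDl// leey.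
  have yz0 : (0 < z - y)%R by rewrite subr_gt0.
  exists (Num.truncn (z - y)^-1) => //; split => //; apply: lt_le_trans zx.
  rewrite lte_fin -ltrBrDl invf_plt ?posrE//.
  by rewrite truncnS_gt.
have ndF : nondecreasing_seq F.
  move=> i j ij; apply/subsetPset => x [px fx]; split => //; apply: le_lt_trans fx.
  by rewrite lee_fin lerD2l lef_pV2 ?posrE ?ltr0n// ler_nat.
have mUF : measurable (\bigcup_n F n) by exact: bigcupT_measurable.
have cF := nondecreasing_cvg_mu (mu := (@dtt R : set (measurableTypeR R) -> \bar R)) mF mUF ndF.
have : exists n, t%:E < dtt (F n).
  apply: contrapT => /forallNP H; move: ty; rewrite ltNge => /negP; apply.
  rewrite /distrib -FU -(cvg_lim _ cF)//; apply: lime_le; first by apply/cvg_ex; eexists; exact: cF.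
  by apply: nearW => n; rewrite leNgt; apply/negP; exact: H.
by case=> n tn; exists (y + n.+1%:R^-1)%R => //; rewrite ltrDl.
Qed.

(** The rearrangement is the generalized inverse of the distribution function;
right continuity makes the equivalence exact with strict inequalities. *)
Lemma lt_rearrangement f (t y : R) : nonneg_meas f -> (0 <= y)%R ->
  (y%:E < rearrangement (@dtt R) f t) = (t%:E < distrib (@dtt R) f y).
Proof.
move=> mf y0; apply/idP/idP; last first.
  move=> /(distrib_right_continuous mf)[z yz tz]; apply: (@lt_le_trans _ _ z%:E).
    by rewrite lte_fin.
  apply/ereal_infP => _ [x [x0 xt] <-]; rewrite lee_fin leNgt; apply/negP => xz.
  move: tz; rewrite ltNge => /negP; apply; apply: le_trans xt.
  apply: le_dtt => s [ps zs]; split => //; apply: lt_trans zs.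
  by rewrite lte_fin.
rewrite !ltNge; apply: contraNN => yt; apply: ge_ereal_inf; exists y%:E => //.
by exists y.
Qed.

Lemma lebesgue_measure_initial (M : \bar R) : 0 <= M ->
  mu [set t | pos_line t /\ t%:E < M] = M.
Proof.
case: M => [r| |//].
- rewrite lee_fin => r0; rewrite (_ : [set _ | _] = `]0%R, r[%classic); last first.
    by apply/seteqP; split => x /=; rewrite pos_lineE in_itv/= lte_fin => /andP.
  rewrite lebesgue_measure_itv/= lte_fin oppr0 adde0; case: ltP => // r0'.
  by congr EFin; apply/eqP; rewrite eq_le r0.
- move=> _; rewrite (_ : [set _ | _] = `]0%R, +oo[%classic); last first.
    by apply/seteqP; split => x /=; rewrite pos_lineE in_itv/= ltry ?andbT // => -[].
  by rewrite lebesgue_measure_itv/= ltry.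
Qed.

Lemma distrib_rearrangement f (y : R) : nonneg_meas f -> (0 <= y)%R ->
  distrib mu (rearrangement (@dtt R) f) y = distrib (@dtt R) f y.
Proof.
move=> mf y0; rewrite {1}/distrib -[RHS]lebesgue_measure_initial; last exact: dtt_ge0.
congr (mu _); apply/seteqP; split => x /= [px];
  by rewrite gee0_abs ?rearrangement_ge0// lt_rearrangement.
Qed.

(** The norm of the rearrangement may be computed from any equimeasurable
function on the half-line, in particular from one depending linearly on f. *)
Lemma ri_rearrangement (E : fnorm R) f h : ri_space E ->
  nonneg_meas f -> nonneg_meas h ->
  (forall y : R, (0 <= y)%R -> distrib mu h y = distrib (@dtt R) f y) ->
  E (rearrangement (@dtt R) f) = E h.
Proof.
move=> hE mf mh fh; apply: (ri_invariant hE) => //.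
  exact: nonneg_meas_rearrangement.
by move=> y y0; rewrite distrib_rearrangement// fh.
Qed.
End Rearrangement.

(** * Norms with respect to dt/t *)

Section FunctionNorm.
Context {R : realType}.
Local Notation mu := (@lebesgue_measure R).
Implicit Types (E : fnorm R) (f g : R -> \bar R) (I J : set R).

Lemma nonneg_meas_patch f I : measurable I -> nonneg_meas f -> nonneg_meas (f \_ I).
Proof.
move=> mI [mf f0]; split.
  have [H _] := measurable_restrict f mI measurable_pos_line; apply: H.
  exact: (measurable_funS measurable_pos_line (@subIsetl _ _ I) mf).
by move=> x px; rewrite /patch; case: (x \in I) => //; exact: f0.
Qed.

Lemma nonneg_meas_comp f (phi : R -> R) : measurable_fun setT phi ->
  (forall t : R, (0 < t)%R -> (0 < phi t)%R) -> nonneg_meas f ->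
  nonneg_meas (fun t => f (phi t)).
Proof.
move=> mphi phi0 [mf f0]; split; last first.
  by move=> x; rewrite pos_lineE => x0; apply: f0; rewrite pos_lineE; exact: phi0.
apply: (measurable_comp measurable_pos_line _ mf).
  by move=> _ [x /= + <-]; rewrite !pos_lineE; exact: phi0.
exact: measurable_funTS.
Qed.

Lemma tnorm_ge0 E I f : ri_space E -> 0 <= tnorm E I f.
Proof. by move=> hE; apply: (ri_ge0 hE); exact: nonneg_meas_rearrangement. Qed.

Lemma le_tnorm E I J f g : ri_space E ->
  (forall x : R, (0 < x)%R -> I x -> J x /\ 0 <= f x <= g x) ->
  tnorm E I f <= tnorm E J g.
Proof.
move=> hE fg; apply: (ri_mono hE); try exact: nonneg_meas_rearrangement.
apply: aeW => /= t _; apply: le_rearrangement => y y0.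
apply: le_dtt => x [px yx]; split => //; apply: (lt_le_trans yx).
rewrite pos_lineE in px.
move: yx; rewrite /patch; case: ifPn => [/set_mem Ix _|_].
  by have [Jx /andP[f0 fgx]] := fg _ px Ix; rewrite mem_set// !gee0_abs// (le_trans f0).
by rewrite abse0 lte_fin ltNge y0.
Qed.

Lemma eq_tnorm E I J f g :
  (forall x : R, (0 < x)%R -> (I x <-> J x) /\ (I x -> f x = g x)) ->
  tnorm E I f = tnorm E J g.
Proof.
move=> fg; rewrite /tnorm; congr E; apply/funext => t.
have dE (y : R) : distrib (@dtt R) (f \_ I) y = distrib (@dtt R) (g \_ J) y.
  rewrite /distrib; congr (@dtt R _); apply/seteqP; split => x /= [px yx];
    split => //; move: yx; rewrite pos_lineE in px; have [IJ fgx] := fg _ px;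
    rewrite /patch.
  - case: ifPn => [/set_mem Ix|/negP nI]; first by rewrite mem_set -?fgx//; exact/IJ.
    by case: ifPn => // /set_mem/IJ/mem_set.
  - case: ifPn => [/set_mem /IJ Ix|/negP nJ]; first by rewrite mem_set// -fgx.
    by case: ifPn => // /set_mem/IJ/mem_set.
by apply/eqP; rewrite eq_le !le_rearrangement// => y _; rewrite dE.
Qed.

(** The map t -> u e^t sends Lebesgue measure on (0, oo) to dt/t on (u, oo).
The right-hand side is linear in f under E, which is what the rearrangement
on the left-hand side is not. *)
Lemma tnorm_exp E I f (u : R) : ri_space E -> (0 < u)%R -> measurable I ->
  I `<=` `]u, +oo[ -> nonneg_meas f ->
  tnorm E I f = E (fun t => (f \_ I) (u * expR t)%R).
Proof.
move=> hE u0 mI Iu mf; have mfI := nonneg_meas_patch mI mf.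
have mexp : measurable_fun setT (fun t : R => (u * expR t)%R).
  by apply: measurable_funM => //; exact: measurable_expR.
apply: ri_rearrangement => //.
  by apply: (nonneg_meas_comp mexp) => // t _; rewrite mulr_gt0 ?expR_gt0.
move=> y y0; rewrite /distrib -(dtt_expR u0); last 2 first.
- exact: measurable_superlevel.
- by move=> x [].
congr (mu _); apply/seteqP; split => x /= [px yx]; split => //.
  by rewrite pos_lineE mulr_gt0 ?expR_gt0.
move: yx; rewrite /patch; case: ifPn; last by rewrite abse0 lte_fin ltNge y0.
move=> /set_mem /Iu /=; rewrite in_itv/= andbT => ux _; rewrite pos_lineE.
by rewrite -expR_gt1 -(ltr_pM2l u0) mulr1.
Qed.

Lemma tnorm_expN E I f (u : R) : ri_space E -> (0 < u)%R -> measurable I ->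
  I `<=` `]-oo, u[ -> nonneg_meas f ->
  tnorm E I f = E (fun t => (f \_ I) (u * expR (- t))%R).
Proof.
move=> hE u0 mI Iu mf; have mfI := nonneg_meas_patch mI mf.
have mexp : measurable_fun setT (fun t : R => (u * expR (- t))%R).
  apply: measurable_funM => //; apply: measurableT_comp; first exact: measurable_expR.
  exact: oppr_measurable.
apply: ri_rearrangement => //.
  by apply: (nonneg_meas_comp mexp) => // t _; rewrite mulr_gt0 ?expR_gt0.
move=> y y0; rewrite /distrib -(dtt_expRN u0); last 2 first.
- exact: measurable_superlevel.
- by move=> x [].
congr (mu _); apply/seteqP; split => x /= [px yx]; split => //.
  by rewrite pos_lineE mulr_gt0 ?expR_gt0.
move: yx; rewrite /patch; case: ifPn; last by rewrite abse0 lte_fin ltNge y0.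
move=> /set_mem /Iu /=; rewrite in_itv/= => ux _; rewrite pos_lineE.
by rewrite -oppr_lt0 -expR_lt1 -(ltr_pM2l u0) mulr1.
Qed.

(** A set that accumulates at 0 is exhausted by sets to which [tnorm_exp]
applies, and the rearrangements of the truncated functions increase to that of
f. *)
Lemma tnorm_cvg E I f : ri_space E -> measurable I -> nonneg_meas f ->
  (fun n => tnorm E (I `&` `](n.+1%:R^-1)%R, +oo[) f) @ \oo --> tnorm E I f.
Proof.
move=> hE mI mf.
pose J n : set R := I `&` `](n.+1%:R^-1)%R, +oo[.
have mJ n : measurable (J n) by apply: measurableI => //; exact: measurable_itv.
have mfI := nonneg_meas_patch mI mf.
have mfJ n := nonneg_meas_patch (mJ n) mf.
pose A n (y : R) := [set x | pos_line x /\ y%:E < `|(f \_ (J n)) x|].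
have AE n (y : R) : (0 <= y)%R ->
    A n y = [set x | pos_line x /\ y%:E < `|(f \_ I) x|] `&` `](n.+1%:R^-1)%R, +oo[.
  move=> y0; apply/seteqP; split => x; rewrite /A /J /patch /=.
    case: ifPn => [/set_mem [Ix nx]|_ [_]]; last by rewrite abse0 lte_fin ltNge y0.
    by rewrite (mem_set Ix).
  case: ifPn => [/set_mem Ix|_ [[_]]]; last by rewrite abse0 lte_fin ltNge y0.
  by move=> [? ?]; rewrite mem_set.
have ndA (y : R) : (0 <= y)%R -> nondecreasing_seq (A ^~ y).
  move=> y0 i j ij; apply/subsetPset; rewrite !AE// => x [? /=]; rewrite in_itv/= andbT => ix.
  split => //=; rewrite in_itv/= andbT; apply: le_lt_trans ix.
  by rewrite lef_pV2 ?posrE ?ltr0n// ler_nat.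
apply: (ri_fatou hE); try by move=> *; exact: nonneg_meas_rearrangement.
apply: aeW => /= t _.
have ndr : {homo (fun n => rearrangement (@dtt R) (f \_ (J n)) t) : n m / (n <= m)%N >-> n <= m}.
  move=> i j ij; apply: le_rearrangement => y y0; apply: le_dtt.
  by have /subsetPset := ndA y y0 _ _ ij.
split; first by move=> n; exact: ndr.
rewrite (_ : rearrangement _ (f \_ I) t =
  ereal_sup (range (fun n => rearrangement (@dtt R) (f \_ (J n)) t))); first exact: ereal_nondecreasing_cvgn.
apply/eqP; rewrite eq_le; apply/andP; split; last first.
  apply/ereal_supP => _ [n _ <-]; apply: le_rearrangement => y y0; apply: le_dtt.
  by have := AE n y y0; rewrite /A => -> x [].
set s := ereal_sup _; rewrite leNgt; apply/negP.
have s0 : 0 <= s.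
  apply: le_ereal_sup_tmp; exists (rearrangement (@dtt R) (f \_ (J 0%N)) t); last exact: rearrangement_ge0.
  by exists 0%N.
case sE : s s0 => [r| |] //; last by move=> _; rewrite ltNge leey.
rewrite lee_fin => r0.
rewrite lt_rearrangement//.
have U : \bigcup_n A n r = [set x | pos_line x /\ r%:E < `|(f \_ I) x|].
  apply/seteqP; split => [x [n _]|x Px]; first by rewrite AE// => -[].
  exists (Num.truncn x^-1) => //; rewrite AE//; split => //=.
  rewrite in_itv/= andbT; case: Px; rewrite pos_lineE => x0 _.
  by rewrite invf_plt ?posrE// truncnS_gt.
have mA n : measurable (A n r) by exact: measurable_superlevel.
have mUA : measurable (\bigcup_n A n r) by exact: bigcupT_measurable.
have cA := nondecreasing_cvg_mu (mu := (@dtt R : set (measurableTypeR R) -> \bar R)) mA mUA (ndA _ r0).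
apply/negP; rewrite -leNgt /distrib -U -(cvg_lim _ cA)//.
apply: lime_le; first by apply/cvg_ex; eexists; exact: cA.
apply: nearW => n; rewrite leNgt.
have := @lt_rearrangement _ (f \_ (J n)) t r (mfJ n) r0; rewrite /distrib => /= <-.
rewrite -leNgt -sE; apply: ereal_sup_ubound; by exists n.
Qed.

End FunctionNorm.

(** * Calculus of the norms *)

Section FunctionNormCalculus.
Context {R : realType}.
Local Notation mu := (@lebesgue_measure R).
Implicit Types (E : fnorm R) (f g : R -> \bar R) (I J : set R).

Lemma nonneg_measD f g : nonneg_meas f -> nonneg_meas g ->
  nonneg_meas (fun x => f x + g x).
Proof.
move=> [mf f0] [mg g0]; split; first exact: emeasurable_funD.
by move=> x px; rewrite adde_ge0 ?f0 ?g0.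
Qed.

Lemma nonneg_measM f g : nonneg_meas f -> nonneg_meas g ->
  nonneg_meas (fun x => f x * g x).
Proof.
move=> [mf f0] [mg g0]; split; first exact: emeasurable_funM.
by move=> x px; rewrite mule_ge0 ?f0 ?g0.
Qed.

Lemma nonneg_meas_EFin (a : R -> R) : measurable_fun (@pos_line R) a ->
  (forall x : R, (0 < x)%R -> (0 <= a x)%R) -> nonneg_meas (fun x => (a x)%:E).
Proof.
move=> ma a0; split; first exact/measurable_EFinP.
by move=> x; rewrite pos_lineE lee_fin; exact: a0.
Qed.

Lemma nonneg_meas_cst (c : R) : (0 <= c)%R -> nonneg_meas (fun=> c%:E : \bar R).
Proof. by move=> c0; apply: nonneg_meas_EFin. Qed.

Lemma nonneg_measZ (c : R) f : (0 <= c)%R -> nonneg_meas f ->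
  nonneg_meas (fun x => c%:E * f x).
Proof. by move=> c0 mf; apply: nonneg_measM => //; exact: nonneg_meas_cst. Qed.

Let truncation (n : nat) : set R := `](n.+1%:R^-1)%R, +oo[.

Let tnorm_truncation E I f n : ri_space E -> measurable I -> nonneg_meas f ->
  tnorm E (I `&` truncation n) f =
  E (fun t => (f \_ (I `&` truncation n)) (n.+1%:R^-1 * expR t)%R).
Proof.
move=> hE mI mf; apply: tnorm_exp => //.
by apply: measurableI => //; exact: measurable_itv.
Qed.

Let nonneg_meas_truncation I f n : measurable I -> nonneg_meas f ->
  nonneg_meas (fun t => (f \_ (I `&` truncation n)) (n.+1%:R^-1 * expR t)%R).
Proof.
move=> mI mf; apply: (@nonneg_meas_comp _ _ (fun t => n.+1%:R^-1 * expR t)%R).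
- by apply: measurable_funM => //; exact: measurable_expR.
- by move=> t _; rewrite mulr_gt0 ?expR_gt0.
- apply: nonneg_meas_patch => //.
  by apply: measurableI => //; exact: measurable_itv.
Qed.

(** Before the limit of [tnorm_cvg], both sides are norms of compositions with
the same exponential, where the triangle inequality of E applies. *)
Lemma tnormD E I f g : ri_space E -> measurable I ->
  nonneg_meas f -> nonneg_meas g ->
  tnorm E I (fun x => f x + g x) <= tnorm E I f + tnorm E I g.
Proof.
move=> hE mI mf mg; have mfg := nonneg_measD mf mg.
have cfg := tnorm_cvg hE mI mfg.
rewrite -(cvg_lim _ cfg)//; apply: lime_le; first by apply/cvg_ex; eexists; exact: cfg.
apply: nearW => n.
apply: (@le_trans _ _ (tnorm E (I `&` truncation n) f + tnorm E (I `&` truncation n) g)).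
  rewrite !tnorm_truncation//.
  rewrite (_ : (fun t : R => _) = (fun t => (f \_ (I `&` truncation n)) (n.+1%:R^-1 * expR t)%R +
    (g \_ (I `&` truncation n)) (n.+1%:R^-1 * expR t)%R)).
    by apply: (ri_triangle hE); exact: nonneg_meas_truncation.
  by apply/funext => t; rewrite /patch; case: ifPn => // _; rewrite adde0.
apply: leeD; apply: le_tnorm => // x x0 [Ix _]; split => //; rewrite lexx andbT.
  by have [_] := mf; apply; rewrite pos_lineE.
by have [_] := mg; apply; rewrite pos_lineE.
Qed.

Lemma tnormZ E I (c : R) f : ri_space E -> measurable I -> (0 <= c)%R ->
  nonneg_meas f -> tnorm E I (fun x => c%:E * f x) = c%:E * tnorm E I f.
Proof.
move=> hE mI c0 mf.
have cf := tnorm_cvg hE mI (nonneg_measZ c0 mf).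
have cf' := cvgeZl (y := c%:E) (erefl _) (tnorm_cvg hE mI mf).
rewrite -(cvg_lim _ cf)// -(cvg_lim _ cf')//; congr (limn _); apply/funext => n.
rewrite !tnorm_truncation//; last exact: nonneg_measZ.
rewrite -(ri_homo hE c0); last exact: nonneg_meas_truncation.
by congr E; apply/funext => t; rewrite /patch; case: ifPn => // _; rewrite mule0.
Qed.

Lemma tnormU E I J f : ri_space E -> measurable I -> measurable J ->
  nonneg_meas f -> tnorm E (I `|` J) f <= tnorm E I f + tnorm E J f.
Proof.
move=> hE mI mJ mf.
have patchT K : tnorm E K f = tnorm E setT (f \_ K) by rewrite /tnorm patch_setT.
rewrite !patchT; apply: le_trans (tnormD _ _ _ _) => //; try exact: nonneg_meas_patch.
have f0 x : (0 < x)%R -> 0 <= f x by have [_] := mf; rewrite -pos_lineE; exact.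
apply: le_tnorm => // x x0 _; split => //.
have fx := f0 _ x0; rewrite /patch in_setU; case: (x \in I); case: (x \in J) => //=;
  rewrite ?adde0 ?add0e ?lexx ?fx//.
by rewrite leeDl.
Qed.

(** In logarithmic coordinates the inversion is x -> -x. *)
Lemma dtt_inv (A : set R) : measurable A -> A `<=` @pos_line R ->
  dtt [set x | pos_line x /\ A x^-1%R] = dtt A.
Proof.
move=> mA Apos.
have mB : measurable [set x : R | pos_line x /\ A x^-1%R].
  have mV : measurable_fun (@pos_line R) (fun x => x^-1)%R.
    by apply/measurable_EFinP; exact: measurable_funV_pos.
  exact: (mV measurable_pos_line _ mA).
rewrite -(dtt_expR ltr01)//; last by move=> x [].
rewrite -[RHS](dtt_expRN ltr01)//; congr (mu _); apply/seteqP; split => x /=.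
  by rewrite pos_lineE !mul1r -expRN => -[].
by rewrite pos_lineE !mul1r -expRN => ?; split; rewrite // expR_gt0.
Qed.

Lemma tnorm_inv E I f : ri_space E -> measurable I -> nonneg_meas f ->
  tnorm E I f = tnorm E [set x | I x^-1%R] (fun x => f x^-1%R).
Proof.
move=> hE mI mf.
have dE (y : R) : (0 <= y)%R -> distrib (@dtt R) (f \_ I) y =
    distrib (@dtt R) ((fun x => f x^-1%R) \_ [set x | I x^-1%R]) y.
  move=> y0; rewrite /distrib -dtt_inv; last 2 first.
  - by apply: measurable_superlevel; exact: nonneg_meas_patch.
  - by move=> x [].
  congr (@dtt R _); apply/seteqP; split => x /=; rewrite !pos_lineE.
    move=> [x0 [x'0]]; rewrite /patch; case: ifPn => [/set_mem Ix|_].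
      by [].
    by rewrite abse0 lte_fin ltNge y0.
  move=> [x0]; rewrite /patch; case: ifPn => [/set_mem Ix|_].
    by rewrite invr_gt0.
  by rewrite abse0 lte_fin ltNge y0.
rewrite /tnorm; congr E; apply/funext => t.
by apply/eqP; rewrite eq_le !le_rearrangement// => y y0; rewrite dE.
Qed.

Lemma eq_ri E f g : ri_space E -> nonneg_meas f -> nonneg_meas g ->
  (forall t : R, (0 < t)%R -> f t = g t) -> E f = E g.
Proof.
move=> hE mf mg fg; apply: (ri_invariant hE) => // y _.
rewrite /distrib; congr (mu _); apply/seteqP; split => x /= [px];
  by have := px; rewrite pos_lineE => x0; rewrite fg.
Qed.

End FunctionNormCalculus.

(** * Norms of power functions *)

Section PowerNorms.
Context {R : realType}.
Local Notation mu := (@lebesgue_measure R).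
Implicit Types (E : fnorm R) (f g : R -> \bar R) (I J : set R).

Lemma nonneg_meas_indic (A : set R) : measurable A ->
  nonneg_meas (EFin \o \1_A : R -> \bar R).
Proof. by move=> mA; apply: nonneg_meas_EFin => //; exact: measurable_indic. Qed.

Lemma ri_indic E (A B : set R) : ri_space E -> measurable A -> measurable B ->
  A `<=` @pos_line R -> B `<=` @pos_line R -> mu A = mu B ->
  E (EFin \o \1_A) = E (EFin \o \1_B).
Proof.
move=> hE mA mB Apos Bpos AB; apply: (ri_invariant hE); try exact: nonneg_meas_indic.
have dE C (y : R) : (0 <= y)%R -> C `<=` @pos_line R ->
    distrib mu (EFin \o \1_C) y = if (y < 1)%R then mu C else 0.
  move=> y0 Cpos; rewrite /distrib; case: ifPn => y1.
    congr (mu _); apply/seteqP; split => x /=; rewrite indicE.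
      by case: (boolP (x \in C)) => [/set_mem//|_ [_]]; rewrite normr0 lte_fin ltNge y0.
    by move=> Cx; rewrite mem_set//= normr1 lte_fin; split => //; exact: Cpos.
  rewrite (_ : [set _ | _] = set0) ?measure0//; apply/seteqP; split => // x /=.
  rewrite indicE lte_fin => -[_]; case: (x \in C); rewrite /= ?normr1 ?normr0; last by rewrite ltNge y0.
  by rewrite (negbTE y1).
by move=> y y0; rewrite !dE// AB.
Qed.

Lemma ri_0 E f : ri_space E -> nonneg_meas f ->
  (forall t : R, (0 < t)%R -> f t = 0) -> E f = 0.
Proof.
move=> hE mf f0; apply/(ri_eq0 hE mf); apply: aeW => /= x.
by rewrite pos_lineE; exact: f0.
Qed.

(** On (n, n+1] the exponential is at most the n-th power of e^(-b), and the
indicators of these intervals have equal norms. The partial sums are therefore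
bounded by a geometric series, and the Fatou property passes to the limit. *)
Lemma ri_exp_fin E (b : R) : ri_space E -> (0 < b)%R ->
  E (fun t => (expR (- (b * t)))%:E) < +oo.
Proof.
move=> hE b0; pose h t : \bar R := (expR (- (b * t)))%:E.
pose S n : set R := `]0%R, n%:R]%classic.
pose T n : set R := `]n%:R, n.+1%:R]%classic.
have mh : nonneg_meas h.
  apply: nonneg_meas_EFin; last by move=> *; exact: expR_ge0.
  apply: measurable_funTS; apply: measurableT_comp; first exact: measurable_expR.
  by apply: measurableT_comp; [exact: oppr_measurable|exact: mulrl_measurable].
have mS n : measurable (S n) by exact: measurable_itv.
have mT n : measurable (T n) by exact: measurable_itv.
have mhS n := nonneg_meas_patch (mS n) mh.
have Tpos n : T n `<=` @pos_line R.
  by move=> x; rewrite pos_lineE /T/= in_itv/= => /andP[+ _]; apply: le_lt_trans.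
have muT n : mu (T n) = 1%:E.
  by rewrite lebesgue_measure_itv/= lte_fin ltr_nat ltnSn -EFinB -natrB// subSnn.
have ET n : E (EFin \o \1_(T n)) = E (EFin \o \1_(T 0%N)).
  by apply: ri_indic => //; rewrite !muT.
have Afin : E (EFin \o \1_(T 0%N)) \is a fin_num.
  rewrite ge0_fin_numE; last by apply: (ri_ge0 hE); exact: nonneg_meas_indic.
  by apply: (ri_finite hE) => //; rewrite muT ltry.
pose A := fine (E (EFin \o \1_(T 0%N))).
have A0 : (0 <= A)%R by rewrite fine_ge0//; apply: (ri_ge0 hE); exact: nonneg_meas_indic.
pose q := expR (- b).
have q0 : (0 < q)%R by exact: expR_gt0.
have q1 : (q < 1)%R by rewrite expR_lt1 oppr_lt0.
have step n : E (h \_ (S n.+1)) <= E (h \_ (S n)) + (q ^+ n * A)%:E.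
  rewrite EFinM fineK// -(ET n) -(ri_homo hE); last 2 first.
  - by rewrite exprn_ge0// ltW.
  - exact: nonneg_meas_indic.
  have mq : nonneg_meas (fun x : R => (q ^+ n)%:E * (EFin \o \1_(T n)) x).
    by apply: nonneg_measZ; [rewrite exprn_ge0// ltW|exact: nonneg_meas_indic].
  apply: le_trans (ri_triangle hE _ _) => //.
  apply: (ri_mono hE) => //; first exact: nonneg_measD.
  apply: aeW => /= x; rewrite pos_lineE => x0; rewrite /patch indicE.
  have hx0 : 0 <= h x by rewrite lee_fin expR_ge0.
  have qx0 (c : bool) : 0 <= (q ^+ n)%:E * c%:R%:E.
    by rewrite -EFinM lee_fin mulr_ge0// exprn_ge0// ltW.
  case: ifPn => [/set_mem|_]; last by rewrite adde_ge0//; case: ifPn.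
  rewrite /S/= in_itv/= x0/= => xn1; case: ifPn => [_|]; first by rewrite leeDl.
  move=> /negP xn; rewrite add0e mem_set/= ?mule1; last first.
    rewrite /T/= in_itv/= xn1 andbT ltNge; apply/negP => xn'; apply: xn.
    by apply: mem_set; rewrite /S/= in_itv/= x0.
  rewrite lee_fin /q -expRM_natl ler_expR mulrN lerN2 (mulrC _ b) ler_wpM2l ?(ltW b0)//.
  rewrite leNgt; apply/negP => xn'; apply: xn.
  by apply: mem_set; rewrite /S/= in_itv/= x0 ltW.
have bound n : E (h \_ (S n)) <= (A * (1 - q ^+ n) / (1 - q))%:E.
  elim: n => [|n IH].
    rewrite expr0 subrr mulr0 mul0r (ri_0 hE)// => t t0; rewrite /patch ifF//.
    by apply/negP => /set_mem; rewrite /S/= in_itv/= t0/= leNgt t0.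
  apply: le_trans (step n) _; apply: le_trans (leeD IH (lexx _)) _.
  rewrite -EFinD lee_fin le_eqVlt; apply/orP; left; apply/eqP.
  by rewrite exprS; field; rewrite subr_eq0 eq_sym lt_eqF.
have cv : (fun n => E (h \_ (S n))) @ \oo --> E h.
  apply: (ri_fatou hE) => //; apply: aeW => /= x; rewrite pos_lineE => x0.
  have hx0 : 0 <= h x by rewrite lee_fin expR_ge0.
  split.
    move=> n; rewrite /patch; case: ifPn => [/set_mem Sx|_]; last by case: ifPn.
    rewrite mem_set//; move: Sx; rewrite /S/= !in_itv/= x0/= => /le_trans; apply.
    by rewrite ler_nat.
  apply: cvg_near_cst; near=> n; rewrite /patch mem_set// /S/= in_itv/= x0/=.
  by near: n; exact: nbhs_infty_ger.
rewrite -(cvg_lim _ cv)//; apply: (@le_lt_trans _ _ (A / (1 - q))%:E); last exact: ltry.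
apply: lime_le; first by apply/cvg_ex; eexists; exact: cv.
apply: nearW => n; apply: (le_trans (bound n)); rewrite lee_fin ler_wpM2r//.
  by rewrite invr_ge0 subr_ge0 ltW.
by rewrite ler_piMr// gerBl exprn_ge0// ltW.
Unshelve. all: by end_near. Qed.

(** Both functions become e^(-bt) in logarithmic coordinates based at u, so
that one bound serves all u. *)
Lemma tnorm_power_le E (b : R) : ri_space E -> (0 < b)%R -> exists2 M : R, (0 < M)%R &
  forall u : R, (0 < u)%R ->
    tnorm E `]u, +oo[%classic (fun s => ((s / u) `^ (- b))%:E) <= M%:E /\
    tnorm E `]0%R, u[%classic (fun s => ((s / u) `^ b)%:E) <= M%:E.
Proof.
move=> hE b0; pose h t : \bar R := (expR (- (b * t)))%:E.
have mh : nonneg_meas h.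
  apply: nonneg_meas_EFin; last by move=> *; exact: expR_ge0.
  apply: measurable_funTS; apply: measurableT_comp; first exact: measurable_expR.
  by apply: measurableT_comp; [exact: oppr_measurable|exact: mulrl_measurable].
have Eh : E h \is a fin_num by rewrite ge0_fin_numE ?ri_exp_fin// (ri_ge0 hE).
exists (fine (E h) + 1)%R => [|u u0].
  by rewrite ltr_wpDl// fine_ge0// (ri_ge0 hE).
have le1 : E h <= (fine (E h) + 1)%:E by rewrite EFinD fineK// leeDl.
have mpow (c : R) : nonneg_meas (fun s : R => ((s / u) `^ c)%:E).
  apply: nonneg_meas_EFin => [|x x0]; last exact: powR_ge0.
  apply: measurable_funTS; apply: (measurableT_comp (measurable_powR c)).
  exact: mulrr_measurable.
split.
- rewrite (@tnorm_exp _ _ _ _ u)//; apply: le_trans le1; rewrite le_eqVlt; apply/orP; left; apply/eqP.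
  apply: eq_ri => //.
    apply: nonneg_meas_comp.
    + by apply: measurable_funM => //; exact: measurable_expR.
    + by move=> t _; rewrite mulr_gt0 ?expR_gt0.
    + by apply: nonneg_meas_patch => //; exact: measurable_itv.
  move=> t t0; rewrite /patch mem_set/=; last by rewrite in_itv/= andbT;rewrite ltr_pMr// expR_gt1.
  by rewrite mulrAC divff ?gt_eqF// mul1r -expRM mulrN mulrC.
- rewrite (@tnorm_expN _ _ _ _ u)//; last first.
    by move=> x /=; rewrite !in_itv/= => /andP[].
  apply: le_trans le1; rewrite le_eqVlt; apply/orP; left; apply/eqP.
  apply: eq_ri => //.
    apply: nonneg_meas_comp.
    + apply: measurable_funM => //; apply: measurableT_comp; first exact: measurable_expR.
      exact: oppr_measurable.
    + by move=> t _; rewrite mulr_gt0 ?expR_gt0.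
    + by apply: nonneg_meas_patch => //; exact: measurable_itv.
  move=> t t0; rewrite /patch mem_set/=; last first.
    by rewrite in_itv/= mulr_gt0 ?expR_gt0//= gtr_pMr// expR_lt1 oppr_lt0.
  by rewrite mulrAC divff ?gt_eqF// mul1r -expRM mulNr mulrC.
Qed.

(** In logarithmic coordinates based at u the interval (u, 2u) is (0, ln 2). *)
Lemma tnorm_dyadic_ge E : ri_space E -> exists2 m : R, (0 < m)%R &
  forall u : R, (0 < u)%R -> m%:E <= tnorm E `]u, (2 * u)%R[%classic (fun=> 1).
Proof.
move=> hE; pose A : set R := `]0%R, ln 2[%classic.
have mA : measurable A by exact: measurable_itv.
have ln2 : (0 < ln 2 :> R)%R by rewrite ln_gt0// ltr1n.
have muA : mu A = (ln 2)%:E by rewrite lebesgue_measure_itv/= lte_fin ln2 oppr0 adde0.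
have EA : 0 < E (EFin \o \1_A).
  rewrite lt0e (ri_ge0 hE) ?andbT; last exact: nonneg_meas_indic.
  apply/eqP => /(ri_eq0 hE (nonneg_meas_indic mA)) A0.
  have : mu A <= 0.
    have [B [mB B0 AB]] := A0; rewrite -B0; apply: le_measure; rewrite ?inE//.
    move=> x Ax; apply: AB => /= /(_ _).
    have px : pos_line x by move: Ax; rewrite /A pos_lineE /= in_itv/= => /andP[].
    by move=> /(_ px); rewrite indicE mem_set//= => -[] /eqP; rewrite oner_eq0.
  by rewrite muA lee_fin leNgt ln2.
have [m m0 mE] : exists2 m : R, (0 < m)%R & m%:E <= E (EFin \o \1_A).
  move: EA; case: (E _) => [r| |//]; first by rewrite lte_fin => r0; exists r.
  by exists 1%R; rewrite ?leey.
exists m => // u u0; apply: (le_trans mE).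
rewrite (@tnorm_exp _ _ _ _ u)//; last first.
  by move=> x /=; rewrite !in_itv/= andbT => /andP[].
rewrite le_eqVlt; apply/orP; left; apply/eqP; apply: eq_ri => //.
- exact: nonneg_meas_indic.
- apply: (@nonneg_meas_comp _ _ (fun t => u * expR t)%R).
  + by apply: measurable_funM => //; exact: measurable_expR.
  + by move=> t _; rewrite mulr_gt0 ?expR_gt0.
  + by apply: nonneg_meas_patch; [exact: measurable_itv|exact: nonneg_meas_cst].
move=> t t0; rewrite /= indicE /patch /A.
have -> : (t \in `]0%R, ln 2[%classic) = ((u * expR t)%R \in `]u, (2 * u)%R[%classic).
  have E2 : (t < ln 2)%R = (u * expR t < 2 * u)%R.
    by rewrite mulrC ltr_pM2r// -[X in _ = (_ < X)%R](@lnK _ 2%R) ?posrE// ltr_expR.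
  apply/idP/idP => /set_mem /=; rewrite in_itv/= => /andP[_ H]; apply/mem_set; rewrite /= in_itv/=.
    by rewrite ltr_pMr// expR_gt1 t0/= -E2.
  by rewrite t0/= E2.
by case: ifPn.
Qed.
End PowerNorms.

(** * Weights of power type *)

Section Weights.
Context {R : realType}.
Implicit Types (E F : fnorm R) (w v b : R -> R).

(** A two-sided comparison with powers: p and q are a lower and an upper index
of w. A slowly varying function has indices -e and e for each e > 0, and
indices add up under products, so that sign conditions on p and q are all that
remains of slow variation in the estimates. *)
Record weight (w : R -> R) (p q : R) : Prop := Weight {
  weight_meas : measurable_fun (@pos_line R) w ;
  weight_gt0 : forall t : R, (0 < t)%R -> (0 < w t)%R ;
  weight_growth : exists2 C : R, (0 < C)%R &
    forall s t : R, (0 < s)%R -> (s <= t)%R ->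
      (w t <= C * (t / s) `^ q * w s)%R /\ (w s <= C * (t / s) `^ (- p) * w t)%R
}.

Lemma weight_ge0 w (p q : R) : weight w p q -> forall x : R, (0 < x)%R -> (0 <= w x)%R.
Proof. by move=> hw x x0; apply/ltW/(weight_gt0 hw). Qed.

Lemma weight_powR (p : R) : weight (fun s => s `^ p)%R p p.
Proof.
split.
- by apply: measurable_funTS; exact: measurable_powR.
- by move=> t t0; exact: powR_gt0.
- exists 1%R => // s t s0 st; have t0 := lt_le_trans s0 st.
  have st0 : (0 < t / s)%R by rewrite divr_gt0.
  have tE : (t `^ p = (t / s) `^ p * s `^ p)%R.
    by rewrite -powRM ?(ltW st0)// ?ltW// divfK// gt_eqF.
  by rewrite powRN !mul1r tE mulrA mulVf ?mul1r// gt_eqF// powR_gt0.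
Qed.

Lemma weight_slowly_varying (a : R -> R) (e : R) : slowly_varying a -> (0 < e)%R ->
  weight a (- e) e.
Proof.
move=> ha e0; split; [exact: sv_measurable ha|exact: sv_gt0 ha|].
have [g [c [c0 gnd eg]]] := sv_incr ha e0.
have [h [d [d0 hni eh]]] := sv_decr ha e0.
exists (c * c + d * d)%R; first by rewrite addr_gt0// mulr_gt0.
move=> s t s0 st; have t0 := lt_le_trans s0 st.
have as0 := sv_gt0 ha s0; have at0 := sv_gt0 ha t0.
have st0 : (0 < t / s)%R by rewrite divr_gt0.
have tE : (t `^ e = (t / s) `^ e * s `^ e)%R.
  by rewrite -powRM ?(ltW st0)// ?ltW// divfK// gt_eqF.
have se0 : (0 < s `^ e)%R by exact: powR_gt0.
have ts0 : (0 < (t / s) `^ e)%R by exact: powR_gt0.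
rewrite opprK; split.
- have [+ _] := eh _ t0; have [_ +] := eh _ s0; rewrite -!EFinM !lee_fin => hs ht.
  have : (t `^ (- e) * a t <= d * (d * (s `^ (- e) * a s)))%R.
    by apply: (le_trans ht); rewrite ler_pM2l//; apply: le_trans hs; exact: hni.
  rewrite !powRN tE invfM => H.
  have : (a t <= d * d * (t / s) `^ e * a s)%R.
    rewrite -(ler_pM2l (_ : 0 < ((t / s) `^ e)^-1 * (s `^ e)^-1)%R); last by rewrite mulr_gt0// invr_gt0.
    apply: (le_trans H); rewrite le_eqVlt; apply/orP; left; apply/eqP.
    by field; rewrite !gt_eqF.
  move=> /le_trans; apply; rewrite ler_pM2r// ler_pM2r// lerDr; nra.
- have [+ _] := eg _ s0; have [_ +] := eg _ t0; rewrite -!EFinM !lee_fin => gt gs.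
  have : (s `^ e * a s <= c * (c * (t `^ e * a t)))%R.
    by apply: (le_trans gs); rewrite ler_pM2l//; apply: le_trans gt; exact: gnd.
  rewrite tE => H.
  have : (a s <= c * c * (t / s) `^ e * a t)%R.
    rewrite -(ler_pM2l se0).
    apply: (le_trans H); rewrite le_eqVlt; apply/orP; left; apply/eqP.
    by ring.
  move=> /le_trans; apply; rewrite ler_pM2r// ler_pM2r// lerDl; nra.
Qed.

Lemma weightM (w v : R -> R) (p q p' q' : R) : weight w p q -> weight v p' q' ->
  weight (fun s => w s * v s)%R (p + p') (q + q').
Proof.
move=> [mw w0 [C C0 hC]] [mv v0 [D D0 hD]]; split.
- exact: measurable_funM.
- by move=> t t0; rewrite mulr_gt0 ?w0 ?v0.
- exists (C * D)%R => [|s t s0 st]; first exact: mulr_gt0.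
  have t0 := lt_le_trans s0 st.
  have ts0 : (0 < t / s)%R by rewrite divr_gt0.
  have [C1 C2] := hC _ _ s0 st; have [D1 D2] := hD _ _ s0 st.
  have pD x y : ((t / s) `^ (x + y) = (t / s) `^ x * (t / s) `^ y)%R.
    by rewrite powRD//; apply/implyP => _; rewrite gt_eqF.
  rewrite opprD !pD; split.
  + rewrite (_ : _ * _ * _ = C * (t / s) `^ q * w s * (D * (t / s) `^ q' * v s))%R; last by ring.
    by rewrite ler_pM// ltW// ?w0 ?v0.
  + rewrite (_ : _ * _ * (w t * _) = C * (t / s) `^ (- p) * w t * (D * (t / s) `^ (- p') * v t))%R; last by ring.
    by rewrite ler_pM// ltW// ?w0 ?v0.
Qed.

Lemma weightV (w : R -> R) (p q : R) : weight w p q ->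
  weight (fun s => (w s)^-1)%R (- q) (- p).
Proof.
move=> [mw w0 [C C0 hC]]; split.
- have minv : measurable_fun (@pos_line R) (fun x => x^-1)%R.
    by apply/measurable_EFinP; exact: measurable_funV_pos.
  apply: (measurable_comp measurable_pos_line _ minv mw).
  move=> _ [x /= + <-]; rewrite !pos_lineE; exact: w0.
- by move=> t t0; rewrite invr_gt0 w0.
- exists C => // s t s0 st; have t0 := lt_le_trans s0 st.
  have [C1 C2] := hC _ _ s0 st; rewrite opprK.
  by split; rewrite ler_pdivlMr ?w0// mulrC ler_pdivrMr ?w0.
Qed.

Lemma weight_inv (w : R -> R) (p q : R) : weight w p q ->
  weight (fun s => w s^-1)%R (- q) (- p).
Proof.
move=> [mw w0 [C C0 hC]]; split.
- have minv : measurable_fun (@pos_line R) (fun x => x^-1)%R.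
    by apply/measurable_EFinP; exact: measurable_funV_pos.
  apply: (measurable_comp measurable_pos_line _ mw minv).
  by move=> _ [x /= + <-]; rewrite !pos_lineE invr_gt0.
- by move=> t t0; rewrite w0// invr_gt0.
- exists C => // s t s0 st; have t0 := lt_le_trans s0 st.
  have := hC t^-1%R s^-1%R; rewrite invr_gt0 lef_pV2 ?posrE// invrK opprK => /(_ t0 st)[C1 C2].
  by rewrite (mulrC _ t) in C1 C2; split.
Qed.

Lemma weight_nonneg_meas (w : R -> R) (p q : R) : weight w p q -> nonneg_meas (EFin \o w).
Proof.
by move=> hw; apply: nonneg_meas_EFin (weight_meas hw) _ => x /(weight_gt0 hw)/ltW.
Qed.

(** Over a factor 2 the comparing powers are bounded, so weights are constant
up to a constant on dyadic intervals. *)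
Lemma weight_dyadic (w : R -> R) (p q : R) : weight w p q ->
  exists2 C : R, (0 < C)%R & forall s t : R, (0 < s)%R -> (s <= t <= 2 * s)%R ->
    (w t <= C * w s)%R /\ (w s <= C * w t)%R.
Proof.
move=> [mw w0 [C C0 hC]]; exists (C * (2 `^ `|q| + 2 `^ `|p|))%R.
  by rewrite mulr_gt0// addr_gt0// powR_gt0.
move=> s t s0 /andP[st ts]; have t0 := lt_le_trans s0 st.
have [C1 C2] := hC _ _ s0 st.
have x1 : (1 <= t / s)%R by rewrite ler_pdivlMr// mul1r.
have x2 : (t / s <= 2)%R by rewrite ler_pdivrMr.
have pw (r : R) : ((t / s) `^ r <= 2 `^ `|r|)%R.
  apply: (@le_trans _ _ ((t / s) `^ `|r|)%R).
    by apply: ler_powR => //; exact: ler_norm.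
  by apply: ge0_ler_powR => //; rewrite nnegrE ?(le_trans ler01 x1).
split.
- apply: (le_trans C1); rewrite ler_pM2r ?w0// ler_pM2l//.
  by apply: (le_trans (pw q)); rewrite lerDl powR_ge0.
- apply: (le_trans C2); rewrite ler_pM2r ?w0// ler_pM2l//.
  by apply: (le_trans (pw _)); rewrite normrN lerDr powR_ge0.
Qed.

Lemma powR_neg_swap (x y r : R) : (0 < x)%R -> (0 < y)%R ->
  ((x / y) `^ (- r) = (y / x) `^ r)%R.
Proof.
move=> x0 y0; have xy0 : (0 < x / y)%R by rewrite divr_gt0.
have yx0 : (0 < y / x)%R by rewrite divr_gt0.
have p0 : ((x / y) `^ r != 0)%R by rewrite gt_eqF// powR_gt0.
apply: (mulfI p0); rewrite -powRM ?ltW// powRN divff//.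
by rewrite mulrA divfK ?gt_eqF// divff ?gt_eqF// powR1.
Qed.

Lemma tnorm_le_cst E (I J : set R) (f : R -> \bar R) (g : R -> R) (c M : R) :
  ri_space E -> measurable J -> (0 <= c)%R -> nonneg_meas (EFin \o g) ->
  (forall x : R, (0 < x)%R -> I x -> J x /\ 0 <= f x <= (c * g x)%:E) ->
  tnorm E J (EFin \o g) <= M%:E -> tnorm E I f <= (c * M)%:E.
Proof.
move=> hE mJ c0 mg fg gM.
apply: (@le_trans _ _ (tnorm E J (fun x => c%:E * (EFin \o g) x))).
  exact: le_tnorm.
by rewrite tnormZ// EFinM lee_wpmul2l ?lee_fin.
Qed.

(** A weight of negative upper index is dominated on (u, oo) by w(u) times a
negative power of s/u. *)
Lemma weight_tnorm_tail E (w : R -> R) (p q : R) : ri_space E -> weight w p q -> (q < 0)%R ->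
  exists2 C : R, (0 < C)%R & forall u : R, (0 < u)%R ->
    tnorm E `[u, +oo[%classic (EFin \o w) <= (C * w u)%:E.
Proof.
move=> hE hw q0; have [_ w0 [C C0 hC]] := hw.
have q0' : (0 < - q)%R by rewrite oppr_gt0.
have [M M0 hM] := tnorm_power_le hE q0'.
exists (C * 2 `^ (- q) * M)%R => [|u u0]; first by rewrite !mulr_gt0// powR_gt0.
rewrite (_ : _ * w u = C * 2 `^ (- q) * w u * M)%R; last by ring.
(* the interval is closed at u, whence the base point u/2 of the power *)
have u20 : (0 < u / 2)%R by rewrite divr_gt0.
have [H _] := hM _ u20.
apply: (tnorm_le_cst (J := `](u / 2)%R, +oo[%classic) (g := fun s => (s / (u / 2)) `^ (- - q))%R) => //.
- by rewrite !mulr_ge0 ?powR_ge0// ltW// w0.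
- apply: nonneg_meas_EFin => [|x x0]; last exact: powR_ge0.
  apply: measurable_funTS; apply: (measurableT_comp (measurable_powR _)).
  exact: mulrr_measurable.
move=> s s0 /=; rewrite !in_itv/= !andbT => us; split.
  by rewrite (lt_le_trans _ us)// ltr_pdivrMr// ltr_pMr// ltr1n.
rewrite !lee_fin (ltW (w0 _ s0))/= opprK.
have [+ _] := hC _ _ u0 us; move=> /le_trans; apply.
rewrite (_ : (s / (u / 2)) = (s / u) * 2)%R; last by field; rewrite gt_eqF.
rewrite [((s / u * 2) `^ q)%R]powRM ?divr_ge0 ?(ltW s0) ?(ltW u0)// powRN le_eqVlt; apply/orP; left; apply/eqP.
by field; rewrite gt_eqF// powR_gt0.
Qed.

Lemma weight_tnorm_initial E (w : R -> R) (p q : R) : ri_space E -> weight w p q -> (0 < p)%R ->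
  exists2 C : R, (0 < C)%R & forall u : R, (0 < u)%R ->
    tnorm E `]0%R, u[%classic (EFin \o w) <= (C * w u)%:E.
Proof.
move=> hE hw p0; have [_ w0 [C C0 hC]] := hw.
have [M M0 hM] := tnorm_power_le hE p0.
exists (C * M)%R => [|u u0]; first by rewrite mulr_gt0.
rewrite (_ : _ * w u = C * w u * M)%R; last by ring.
have [_ H] := hM _ u0.
apply: (tnorm_le_cst (J := `]0%R, u[%classic) (g := fun s => (s / u) `^ p)%R) => //.
- by rewrite mulr_ge0// ltW// w0.
- apply: nonneg_meas_EFin => [|x x0]; last exact: powR_ge0.
  apply: measurable_funTS; apply: (measurableT_comp (measurable_powR _)).
  exact: mulrr_measurable.
move=> s s0 /=; rewrite !in_itv/= => su; split => //; move: su => /andP[_ /ltW su].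
rewrite !lee_fin (ltW (w0 _ s0))/=.
have [_] := hC _ _ s0 su; move=> /le_trans; apply.
by rewrite powR_neg_swap// mulrAC.
Qed.

Lemma weight_tnorm_dyadic E (w : R -> R) (p q : R) : ri_space E -> weight w p q ->
  exists2 C : R, (0 < C)%R & forall u : R, (0 < u)%R ->
    tnorm E `[u, (2 * u)%R[%classic (EFin \o w) <= (C * w u)%:E.
Proof.
move=> hE hw; have w0 := weight_gt0 hw; have [C C0 hC] := weight_dyadic hw.
have [M M0 hM] := tnorm_power_le hE ltr01.
exists (C * 2 * M)%R => [|u u0]; first by rewrite !mulr_gt0.
rewrite (_ : _ * w u = C * 2 * w u * M)%R; last by ring.
have u20 : (0 < 2 * u)%R by rewrite mulr_gt0.
have [_ H] := hM _ u20.
apply: (tnorm_le_cst (J := `]0%R, (2 * u)%R[%classic) (g := fun s => (s / (2 * u)) `^ 1)%R) => //.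
- by rewrite !mulr_ge0// ltW// w0.
- apply: nonneg_meas_EFin => [|x x0]; last exact: powR_ge0.
  apply: measurable_funTS; apply: (measurableT_comp (measurable_powR _)).
  exact: mulrr_measurable.
move=> s s0 /=; rewrite !in_itv/= s0 => /andP[us su]; split => //.
rewrite !lee_fin (ltW (w0 _ s0))/= powRr1 ?divr_ge0 ?(ltW s0) ?(ltW u20)//.
have us2 : (u <= s <= 2 * u)%R by rewrite us ltW.
have [+ _] := hC u s u0 us2; move=> /le_trans; apply.
rewrite (_ : _ * (s / _) = C * w u * (s / u))%R; last by field; rewrite gt_eqF.
by rewrite ler_peMr ?mulr_ge0 ?(ltW (w0 _ _)) ?(ltW C0)// ler_pdivlMr// mul1r.
Qed.

Lemma tnorm_dyadic_lower E : ri_space E -> exists2 m : R, (0 < m)%R &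
  forall (u c : R) (h : R -> \bar R), (0 < u)%R -> (0 <= c)%R ->
    (forall s : R, (u < s < 2 * u)%R -> c%:E <= h s) ->
    (m * c)%:E <= tnorm E `]u, (2 * u)%R[%classic h.
Proof.
move=> hE; have [m m0 hm] := tnorm_dyadic_ge hE; exists m => // u c h u0 c0 ch.
apply: (@le_trans _ _ (tnorm E `]u, (2 * u)%R[%classic (fun=> c%:E * 1))).
  rewrite tnormZ//.
  by rewrite mulrC EFinM lee_wpmul2l ?hm.
apply: le_tnorm => // x x0; rewrite /= in_itv/= => xu; split => //.
by rewrite mule1 lee_fin c0 ch.
Qed.
End Weights.

(** * Nested norms over tails *)

Section TailProfiles.
Context {R : realType}.
Implicit Types (E F : fnorm R) (w b k : R -> R).


Record quasiconcave (k : R -> R) : Prop := Quasiconcave {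
  qc_ge0 : forall s : R, (0 < s)%R -> (0 <= k s)%R ;
  qc_mono : forall s t : R, (0 < s)%R -> (s <= t)%R -> (k s <= k t)%R ;
  qc_slope : forall s t : R, (0 < s)%R -> (s <= t)%R -> (s * k t <= t * k s)%R
}.

(** The norm of the space of type R as a functional of the profile k of the
K-functional, w standing for s^(-th) a(s). *)
Definition tailnorm E F b w k : \bar R :=
  tnorm E (@pos_line R)
    (fun t => (b t)%:E * tnorm F `]t, +oo[%classic (fun s => (w s * k s)%:E)).

(** The first term of the right-hand side of the theorem. *)
Definition tailtrunc E F b w (u : R) k : \bar R :=
  tnorm E `]0%R, u[%classic
    (fun t => (b t)%:E * tnorm F `]t, u[%classic (fun s => (w s * k s)%:E)).

Lemma lee_wpmul2l_fin (c : R) (x y : \bar R) : (0 <= c)%R -> x <= y -> c%:E * x <= c%:E * y.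
Proof. by move=> c0 xy; rewrite lee_wpmul2l ?lee_fin. Qed.

Lemma quasiconcave_nonneg_meas k : quasiconcave k -> nonneg_meas (EFin \o k).
Proof.
move=> hk; apply: nondecreasing_nonneg_meas => [s t s0 st|t t0]; rewrite /= lee_fin.
  exact: qc_mono.
exact: qc_ge0.
Qed.

Lemma nonneg_meas_weight_mul w (p q : R) k : weight w p q -> quasiconcave k ->
  nonneg_meas (fun s => (w s * k s)%:E).
Proof.
move=> hw hk; under eq_fun do rewrite EFinM.
by apply: nonneg_measM; [exact: weight_nonneg_meas hw|exact: quasiconcave_nonneg_meas].
Qed.

Lemma nonneg_meas_inner_tail F b (p q : R) (J : R -> set R) (h : R -> \bar R) : ri_space F ->
  weight b p q -> (forall s t : R, (s <= t)%R -> J t `<=` J s) ->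
  (forall x : R, (0 < x)%R -> 0 <= h x) ->
  nonneg_meas (fun t => (b t)%:E * tnorm F (J t) h).
Proof.
move=> hF hb JJ h0; apply: nonneg_measM; first exact: weight_nonneg_meas hb.
apply: nonincreasing_nonneg_meas => [s t _ st|t _]; last exact: tnorm_ge0.
by apply: le_tnorm => // x x0 Jx; rewrite lexx h0//; split => //; exact: JJ Jx.
Qed.

Lemma sub_itv_oy (s t : R) : (s <= t)%R -> `]t, +oo[%classic `<=` `]s, +oo[%classic.
Proof. by move=> st x /=; rewrite !in_itv/= !andbT; exact: le_lt_trans. Qed.

Lemma sub_itv_oo (u s t : R) : (s <= t)%R -> `]t, u[%classic `<=` `]s, u[%classic.
Proof. by move=> st x /=; rewrite !in_itv/= => /andP[/(le_lt_trans st) -> ->]. Qed.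

Lemma tnorm_leZ E (I J : set R) (c : R) (f g : R -> \bar R) : ri_space E ->
  measurable J -> (0 <= c)%R -> nonneg_meas g ->
  (forall x : R, (0 < x)%R -> I x -> J x /\ 0 <= f x <= c%:E * g x) ->
  tnorm E I f <= c%:E * tnorm E J g.
Proof. by move=> hE mJ c0 mg fg; rewrite -tnormZ//; exact: le_tnorm. Qed.

Lemma tnorm_leZD E (I J : set R) (c : R) (f g h : R -> \bar R) : ri_space E ->
  measurable J -> (0 <= c)%R -> nonneg_meas g -> nonneg_meas h ->
  (forall x : R, (0 < x)%R -> I x -> J x /\ 0 <= f x <= c%:E * (g x + h x)) ->
  tnorm E I f <= c%:E * (tnorm E J g + tnorm E J h).
Proof.
move=> hE mJ c0 mg mh fgh; have mgh := nonneg_measD mg mh.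
apply: (le_trans (tnorm_leZ hE mJ c0 mgh fgh)).
by apply: lee_wpmul2l_fin => //; exact: tnormD.
Qed.

Section InitialNorm.
Variables (E : fnorm R) (b : R -> R) (p q : R).
Hypotheses (hE : ri_space E) (hb : weight b p q).
Let B u := tnorm E `]0%R, u[%classic (EFin \o b).

(** The part of the norm over (u/2, u) is already comparable with b(u). *)
Lemma le_initial_norm : exists2 C : R, (0 < C)%R &
  forall u : R, (0 < u)%R -> (b u)%:E <= C%:E * B u.
Proof.
have b0 := weight_gt0 hb.
have [C C0 hC] := weight_dyadic hb; have [m m0 hm] := tnorm_dyadic_lower hE.
exists (C / m)%R => [|u u0]; first by rewrite divr_gt0.
have u20 : (0 < u / 2)%R by rewrite divr_gt0.
have uE : (2 * (u / 2) = u)%R by field.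
have h : (m * (b u / C))%:E <= B u.
  have bc : forall s : R, (u / 2 < s < 2 * (u / 2))%R -> (b u / C)%:E <= (EFin \o b) s.
    rewrite uE => s /andP[us su]; rewrite lee_fin ler_pdivrMr// mulrC.
    have s0 : (0 < s)%R by exact: lt_trans us.
    have [] // := hC s u s0; rewrite (ltW su)/= mulrC -ler_pdivrMr//; exact: ltW.
  have := hm _ _ _ u20 _ bc; rewrite uE => /(_ (divr_ge0 (ltW (b0 _ u0)) (ltW C0))).
  move=> /le_trans; apply; apply: le_tnorm => // x x0 /=; rewrite !in_itv/= x0/= => /andP[_ ->].
  by split => //; rewrite lexx lee_fin ltW// b0.
rewrite (_ : (b u)%:E = (C / m)%:E * (m * (b u / C))%:E).
  by rewrite lee_wpmul2l_fin// divr_ge0// ltW.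
by rewrite -EFinM; congr EFin; field; rewrite !gt_eqF.
Qed.

(** The contribution of [u, 2u) is at most b(u) up to a constant, and hence at
most the norm over (0, u). *)
Lemma initial_norm_doubling : exists2 C : R, (0 < C)%R &
  forall u : R, (0 < u)%R -> B (2 * u) <= C%:E * B u.
Proof.
have [C C0 hC] := weight_tnorm_dyadic hE hb; have [D D0 hD] := le_initial_norm.
exists (1 + C * D)%R => [|u u0]; first by rewrite addr_gt0// mulr_gt0.
have uu : (u <= 2 * u)%R by lra.
have CD0 : (0 <= C * D)%R by rewrite mulr_ge0// ltW.
rewrite EFinD ge0_muleDl ?lee_fin// mul1e.
apply: (@le_trans _ _ (B u + tnorm E `[u, (2 * u)%R[%classic (EFin \o b))).
  rewrite /B (_ : `]0%R, (2 * u)%R[%classic = `]0%R, u[%classic `|` `[u, (2 * u)%R[%classic); last first.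
    apply/seteqP; split => x /=; rewrite !in_itv/=.
      by move=> /andP[-> ->]; rewrite andbT; case: (ltP x u) => _; [left|right].
    case=> /andP[x0 x1]; first by rewrite x0/= (lt_le_trans x1).
    by rewrite x1 (lt_le_trans u0).
  by apply: tnormU => //; exact: weight_nonneg_meas hb.
rewrite leeD2l//; apply: (le_trans (hC _ u0)); rewrite !EFinM -muleA.
by rewrite lee_wpmul2l_fin ?hD// ltW.
Qed.

Lemma initial_norm_gt0 (u : R) : (0 < u)%R -> 0 < B u.
Proof.
move=> u0; have [C C0 hC] := le_initial_norm; rewrite lt0e tnorm_ge0// andbT.
apply/eqP => B0; have := hC _ u0; rewrite B0 mule0 lee_fin leNgt.
by rewrite (weight_gt0 hb).
Qed.

Lemma initial_norm_mono (u v : R) : (u <= v)%R -> B u <= B v.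
Proof.
move=> uv; apply: le_tnorm => // x x0 /=; rewrite !in_itv/= x0/= => xu.
by rewrite (lt_le_trans xu uv) lexx lee_fin ltW// (weight_gt0 hb).
Qed.

(** Finiteness for one v spreads to all u by iterated doubling. *)
Lemma initial_norm_fin (v u : R) : (0 < v)%R -> B v < +oo -> (0 < u)%R -> B u < +oo.
Proof.
move=> v0 Bv u0; have [C C0 hC] := initial_norm_doubling.
have Bn n : B (2 ^+ n * v) < +oo.
  elim: n => [|n IH]; first by rewrite expr0 mul1r.
  rewrite exprS -mulrA; apply: le_lt_trans (hC _ _) _.
    by rewrite mulr_gt0// exprn_gt0.
  by rewrite lte_mul_pinfty ?lee_fin ?ltW.
apply: le_lt_trans (Bn (Num.truncn (u / v)).+1); apply: initial_norm_mono.
rewrite -ler_pdivrMr//; apply: (@le_trans _ _ (Num.truncn (u / v)).+1%:R).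
  by rewrite ltW// truncnS_gt.
by rewrite -natrX ler_nat ltnW// ltn_expl.
Qed.

(** A lower bound for an inner norm, uniform in t < v, factors out of the outer
norm. *)
Lemma initial_norm_mul_le (v c : R) (J : set R) (g : R -> \bar R) :
  (0 <= c)%R -> `]0%R, v[%classic `<=` J ->
  (forall t : R, (0 < t < v)%R -> c%:E <= g t) ->
  c%:E * B v <= tnorm E J (fun t => (b t)%:E * g t).
Proof.
move=> c0 vJ cg; rewrite /B -tnormZ; [|exact: hE|exact: measurable_itv|exact: c0|exact: weight_nonneg_meas hb].
apply: le_tnorm; first exact: hE.
move=> x x0 xv; split; first exact: vJ.
have bx : (0 <= b x)%R by rewrite ltW// (weight_gt0 hb).
apply/andP; split; first by rewrite /= -EFinM lee_fin mulr_ge0.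
by rewrite [leLHS]muleC; apply: lee_wpmul2l_fin (bx) _; apply: cg; move: xv; rewrite /= in_itv/=.
Qed.
End InitialNorm.

Section TailHalf.
Variables (E F : fnorm R) (b w : R -> R) (pb qb pw qw : R).
Hypotheses (hE : ri_space E) (hF : ri_space F).
Hypotheses (hb : weight b pb qb) (hw : weight w pw qw).
Let B u := tnorm E `]0%R, u[%classic (EFin \o b).

Lemma weight_mul_ge0 k : quasiconcave k -> forall x : R, (0 < x)%R -> 0 <= (w x * k x)%:E.
Proof.
by move=> hk x x0; rewrite lee_fin mulr_ge0 ?(qc_ge0 hk)// ltW// (weight_gt0 hw).
Qed.

Lemma inner_norm_ge0 (J : set R) h t : (0 < t)%R -> 0 <= (b t)%:E * tnorm F J h.
Proof.
by move=> t0; apply: mule_ge0; [rewrite lee_fin; exact: (weight_ge0 hb)|exact: tnorm_ge0].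
Qed.

Lemma tailtrunc_le (u : R) k : quasiconcave k -> tailtrunc E F b w u k <= tailnorm E F b w k.
Proof.
move=> hk; apply: le_tnorm; first exact: hE.
move=> t t0 _; rewrite pos_lineE; split; first exact: t0.
apply/andP; split; first exact: inner_norm_ge0.
apply: lee_wpmul2l_fin; first exact: (weight_ge0 hb).
apply: le_tnorm; first exact: hF.
move=> x x0 /=; rewrite !in_itv/= => /andP[-> _]; split; first by [].
by apply/andP; split; [exact: weight_mul_ge0|exact: lexx].
Qed.

Lemma nonneg_meas_tailtrunc (u : R) k : quasiconcave k -> nonneg_meas (fun t =>
    (b t)%:E * tnorm F `]t, u[%classic (fun s => (w s * k s)%:E)).
Proof.
move=> hk; apply: (nonneg_meas_inner_tail (J := fun t => `]t, u[%classic) hF hb); last exact: weight_mul_ge0.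
exact: sub_itv_oo.
Qed.

Lemma tailtrunc_le_sum (u D : R) k k1 k2 : (0 <= D)%R ->
  quasiconcave k -> quasiconcave k1 -> quasiconcave k2 ->
  (forall s : R, (0 < s)%R -> (k s <= D * (k1 s + k2 s))%R) ->
  tailtrunc E F b w u k <= D%:E * (tailtrunc E F b w u k1 + tailtrunc E F b w u k2).
Proof.
move=> D0 hk hk1 hk2 hD.
apply: tnorm_leZD; [exact: hE|exact: measurable_itv|exact: D0|exact: nonneg_meas_tailtrunc|exact: nonneg_meas_tailtrunc|].
move=> t t0 tu; split; first exact: tu.
apply/andP; split; first exact: inner_norm_ge0.
rewrite -ge0_muleDr; [|exact: tnorm_ge0|exact: tnorm_ge0].
rewrite muleCA; apply: lee_wpmul2l_fin; first exact: (weight_ge0 hb).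
apply: tnorm_leZD; [exact: hF|exact: measurable_itv|exact: D0|
  exact: nonneg_meas_weight_mul hw _|exact: nonneg_meas_weight_mul hw _|].
move=> x x0 xt; split; first exact: xt.
apply/andP; split; first exact: weight_mul_ge0.
by rewrite -EFinD -EFinM lee_fin -mulrDr mulrCA ler_pM2l ?(weight_gt0 hw)// hD.
Qed.

Lemma tailtrunc_le_initial (u M : R) k : quasiconcave k -> (0 <= M)%R ->
  tnorm F `]0%R, u[%classic (fun s => (w s * k s)%:E) <= M%:E ->
  tailtrunc E F b w u k <= M%:E * B u.
Proof.
move=> hk M0 hM.
apply: tnorm_leZ; [exact: hE|exact: measurable_itv|exact: M0|exact: weight_nonneg_meas hb|].
move=> t t0 tu; split; first exact: tu.
apply/andP; split; first exact: inner_norm_ge0.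
rewrite [leRHS]muleC; apply: lee_wpmul2l_fin; first exact: (weight_ge0 hb).
apply: le_trans hM; apply: le_tnorm; first exact: hF.
move=> x x0 /=; rewrite !in_itv/= x0 => /andP[_ ->]; split; first by [].
by apply/andP; split; [exact: weight_mul_ge0|exact: lexx].
Qed.

(** For t < u/2 the inner norm contains the whole interval (u/2, u), where w and
k are comparable with w(u) and k(u); doubling replaces the norm of b over
(0, u/2) by the one over (0, u). *)
Lemma tailtrunc_ge : exists2 C : R, (0 < C)%R &
  forall (u : R) k, (0 < u)%R -> quasiconcave k ->
    (w u * k u)%:E * B u <= C%:E * tailtrunc E F b w u k.
Proof.
have w0 := weight_gt0 hw.
have [C C0 hC] := weight_dyadic hw; have [m m0 hm] := tnorm_dyadic_lower hF.
have [D D0 hD] := initial_norm_doubling hE hb.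
exists (2 * C * D / m)%R => [|u k u0 hk]; first by rewrite divr_gt0// !mulr_gt0.
have u20 : (0 < u / 2)%R by rewrite divr_gt0.
have uE : (2 * (u / 2) = u)%R by field.
have u2u : (u / 2 <= u)%R by lra.
have wk0 : (0 <= w u * k u)%R by rewrite mulr_ge0 ?(qc_ge0 hk)// ltW// w0.
pose c := (w u * k u / (2 * C))%R.
have c0 : (0 <= c)%R by rewrite divr_ge0// mulr_ge0// ltW.
have cF : forall s : R, (u / 2 < s < 2 * (u / 2))%R -> c%:E <= (w s * k s)%:E.
  rewrite uE => s /andP[us su]; have s0 : (0 < s)%R by exact: lt_trans us.
  have us2 : (s <= u <= 2 * s)%R by apply/andP; split; lra.
  have [h1 _] := hC _ _ s0 us2.
  have h2 : (k u <= 2 * k s)%R.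
    have h3 := qc_slope hk s0 (ltW su).
    have ku := qc_ge0 hk u0; have ks := qc_ge0 hk s0.
    rewrite -(ler_pM2l s0); apply: (le_trans h3); rewrite mulrA ler_wpM2r//.
    by move: us2 => /andP[_]; rewrite mulrC.
  rewrite lee_fin /c ler_pdivrMr ?mulr_gt0//.
  rewrite (_ : _ * _ * _ = C * w s * (2 * k s))%R; last by ring.
  by apply: ler_pM => //; [rewrite ltW// w0|exact: qc_ge0].
have inner (t : R) : (0 < t < u / 2)%R -> (m * c)%:E <= tnorm F `]t, u[%classic (fun s => (w s * k s)%:E).
  move=> /andP[t0 tu]; apply: (le_trans (hm _ _ _ u20 c0 cF)); rewrite uE.
  apply: le_tnorm; first exact: hF.
  move=> x x0 /=; rewrite !in_itv/= => /andP[ux ->]; rewrite andbT; split.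
    exact: lt_trans ux.
  by apply/andP; split; [exact: weight_mul_ge0|exact: lexx].
have mc0 : (0 <= m * c)%R by rewrite mulr_ge0// ltW.
have sub : `]0%R, (u / 2)%R[%classic `<=` `]0%R, u[%classic.
  by move=> x /=; rewrite !in_itv/= => /andP[-> /lt_le_trans ->].
have low := initial_norm_mul_le hE hb mc0 sub inner.
have {}hD := hD _ u20; rewrite uE in hD.
apply: (le_trans (lee_wpmul2l_fin wk0 hD)).
have K0 : (0 <= 2 * C * D / m)%R by rewrite divr_ge0 ?mulr_ge0 ?ltW.
apply: le_trans (lee_wpmul2l_fin K0 low).
rewrite !muleA -!EFinM le_eqVlt; apply/orP; left; apply/eqP; congr (_%:E * _).
by rewrite /c; field; rewrite !gt_eqF.
Qed.

Lemma tailnorm_ge : exists2 C : R, (0 < C)%R &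
  forall (u : R) k, (0 < u)%R -> quasiconcave k ->
    (w u * k u)%:E * B u <= C%:E * tailnorm E F b w k.
Proof.
have [C C0 hC] := tailtrunc_ge; exists C; first exact: C0.
move=> u k u0 hk; apply: (le_trans (hC _ _ u0 hk)).
by apply: lee_wpmul2l_fin; [exact: ltW|exact: tailtrunc_le].
Qed.

Hypotheses (qw_lt0 : (qw < 0)%R) (qwb_lt0 : (qb + qw < 0)%R).

(** The tails beyond u see only the constant k(u), so their contributions are
multiples of w(u) k(u) and of b(u) w(u) k(u), and [tailtrunc_ge] absorbs
both. *)
Lemma tailnorm_le_trunc : exists2 C : R, (0 < C)%R &
  forall (u D : R) k l, (0 < u)%R -> (0 <= D)%R -> quasiconcave k -> quasiconcave l ->
    (forall s : R, (0 < s)%R -> (s <= u)%R -> (l s <= D * k s)%R) ->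
    (forall s : R, (u <= s)%R -> (l s <= D * k u)%R) ->
    tailnorm E F b w l <= (C * D)%:E * tailtrunc E F b w u k.
Proof.
have w0 := weight_gt0 hw.
have [C1 C10 hC1] := weight_tnorm_tail hF hw qw_lt0.
have [C2 C20 hC2] := tailtrunc_ge.
have [C3 C30 hC3] := weight_tnorm_tail hE (weightM hb hw) qwb_lt0.
have [C4 C40 hC4] := le_initial_norm hE hb.
exists (1 + C1 * C2 + C1 * C3 * C4 * C2)%R => [|u D k l u0 D0 hk hl lk lu].
  by rewrite !addr_gt0// !mulr_gt0.
have ku0 := qc_ge0 hk u0; have wu0 := w0 _ u0; have bu0 := weight_ge0 hb u0.
pose P := tailtrunc E F b w u k.
have P0 : 0 <= P by apply: tnorm_ge0; exact: hE.
pose h t := (b t)%:E * tnorm F `]t, +oo[%classic (fun s => (w s * l s)%:E).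
pose g t := (b t)%:E * tnorm F `]t, u[%classic (fun s => (w s * k s)%:E).
have mh : nonneg_meas h.
  apply: (nonneg_meas_inner_tail (J := fun t => `]t, +oo[%classic) hF hb); last exact: weight_mul_ge0.
  exact: sub_itv_oy.
have mg : nonneg_meas g by exact: nonneg_meas_tailtrunc.
have mb := weight_nonneg_meas hb.
have mw := weight_nonneg_meas hw.
have mwl := nonneg_meas_weight_mul hw hl.
have mwk := nonneg_meas_weight_mul hw hk.
have far (v : R) : (u <= v)%R ->
    tnorm F `[v, +oo[%classic (fun s => (w s * l s)%:E) <= (D * k u * (C1 * w v))%:E.
  move=> uv; have v0 := lt_le_trans u0 uv.
  apply: (tnorm_le_cst (J := `[v, +oo[%classic) (g := w));
    [exact: hF|exact: measurable_itv|exact: mulr_ge0|exact: mw| |exact: hC1].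
  move=> x x0 xv; split; first exact: xv.
  apply/andP; split; first exact: weight_mul_ge0.
  rewrite lee_fin mulrC ler_pM2r ?w0//; apply: lu.
  by move: xv; rewrite /= in_itv/= andbT; exact: le_trans.
have e1 : (0 <= C1 * w u * k u)%R by rewrite !mulr_ge0// ltW.
have close : tnorm E `]0%R, u[%classic h <= D%:E * (P + (C1 * C2)%:E * P).
  apply: (@le_trans _ _ (D%:E * (P + tnorm E `]0%R, u[%classic
      (fun t => (C1 * w u * k u)%:E * (EFin \o b) t)))).
    apply: tnorm_leZD; [exact: hE|exact: measurable_itv|exact: D0|exact: mg|exact: nonneg_measZ|].
    move=> t t0 tu; split; first exact: tu.
    move: tu => /=; rewrite in_itv/= t0 => /= tu.
    apply/andP; split; first exact: inner_norm_ge0.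
    rewrite /g (muleC (C1 * w u * k u)%:E) -ge0_muleDr; [|exact: tnorm_ge0|by rewrite lee_fin].
    rewrite muleCA; apply: lee_wpmul2l_fin; first exact: (weight_ge0 hb).
    apply: (@le_trans _ _ (tnorm F `]t, u[%classic (fun s => (w s * l s)%:E) +
                           tnorm F `[u, +oo[%classic (fun s => (w s * l s)%:E))).
      rewrite (_ : `]t, +oo[%classic = `]t, u[%classic `|` `[u, +oo[%classic).
        by apply: tnormU; [exact: hF|exact: measurable_itv|exact: measurable_itv|exact: mwl].
      apply/seteqP; split => x /=; rewrite !in_itv/= !andbT.
        by move=> ->; case: (ltP x u) => _; [left|right].
      by case=> [/andP[]//|]; exact: lt_le_trans.
    rewrite ge0_muleDr; [|exact: tnorm_ge0|by rewrite lee_fin].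
    apply: leeD; last first.
      by apply: (le_trans (far _ (lexx u))); rewrite -EFinM lee_fin le_eqVlt; apply/orP; left; apply/eqP; ring.
    apply: tnorm_leZ; [exact: hF|exact: measurable_itv|exact: D0|exact: mwk|].
    move=> x x0 xtu; split; first exact: xtu.
    apply/andP; split; first exact: weight_mul_ge0.
    rewrite -EFinM lee_fin mulrCA ler_pM2l ?w0//; apply: lk; first exact: x0.
    by move: xtu; rewrite /= in_itv/= => /andP[_ /ltW].
  apply: lee_wpmul2l_fin; first exact: D0.
  apply: leeD; first exact: lexx.
  rewrite tnormZ; [|exact: hE|exact: measurable_itv|exact: e1|exact: mb].
  rewrite -mulrA (EFinM C1 (w u * k u)) (EFinM C1 C2) -!muleA; apply: lee_wpmul2l_fin; [exact: ltW|exact: hC2].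
have away : tnorm E `[u, +oo[%classic h <= D%:E * ((C1 * C3 * C4 * C2)%:E * P).
  apply: (@le_trans _ _ ((D * k u * C1) * (C3 * (b u * w u)))%:E).
    apply: (tnorm_le_cst (J := `[u, +oo[%classic) (g := fun s => b s * w s)%R);
      [exact: hE|exact: measurable_itv| |exact: weight_nonneg_meas (weightM hb hw)| |exact: hC3].
    - by rewrite !mulr_ge0// ltW.
    - move=> t t0 tu; split; first exact: tu.
      apply/andP; split; first exact: inner_norm_ge0.
      rewrite (_ : (_ * (b t * w t) = b t * (D * k u * (C1 * w t)))%R); last by ring.
      rewrite EFinM; apply: lee_wpmul2l_fin; first exact: (weight_ge0 hb).
      have ut : (u <= t)%R by move: tu; rewrite /= in_itv/= andbT.
      apply: le_trans (far _ ut); apply: le_tnorm; first exact: hF.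
      move=> x x0 /=; rewrite !in_itv/= !andbT => /ltW ->; split; first by [].
      by apply/andP; split; [exact: weight_mul_ge0|exact: lexx].
  rewrite (_ : (_ * (C3 * _)) = D * ((C1 * C3) * ((w u * k u) * b u)))%R; last by ring.
  rewrite EFinM; apply: lee_wpmul2l_fin; first exact: D0.
  rewrite (_ : (C1 * C3 * C4 * C2)%:E = (C1 * C3)%:E * ((C4)%:E * C2%:E)); last first.
    by rewrite -!EFinM; congr EFin; ring.
  rewrite EFinM -muleA; apply: lee_wpmul2l_fin; first by rewrite mulr_ge0// ltW.
  rewrite EFinM; apply: (le_trans (lee_wpmul2l_fin _ (hC4 _ u0))).
    by rewrite mulr_ge0// ltW.
  rewrite muleCA -muleA; apply: lee_wpmul2l_fin; first exact: ltW.
  exact: hC2.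
apply: (@le_trans _ _ (tnorm E `]0%R, u[%classic h + tnorm E `[u, +oo[%classic h)).
  apply: le_trans (tnormU hE (measurable_itv _) (measurable_itv _) mh).
  apply: le_tnorm; first exact: hE.
  move=> x x0 _; split.
    by rewrite /= !in_itv/= x0 andbT; case: (ltP x u) => _; [left|right].
  by apply/andP; split; [exact: inner_norm_ge0|exact: lexx].
apply: (le_trans (leeD close away)).
have c1 : (0 <= C1 * C2)%R by rewrite !mulr_ge0// ltW.
have c2 : (0 <= C1 * C3 * C4 * C2)%R by rewrite !mulr_ge0// ltW.
have c12 : (0 <= 1 + C1 * C2)%R by rewrite addr_ge0.
rewrite -ge0_muleDr; [|by rewrite adde_ge0// mule_ge0// lee_fin|by rewrite mule_ge0// lee_fin].
rewrite (mulrC (1 + _ + _)%R D) (EFinM D) -muleA (EFinD (1 + _)%R) (EFinD 1%R).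
rewrite ge0_muleDl; [|by rewrite -EFinD lee_fin|by rewrite lee_fin].
by rewrite ge0_muleDl ?lee_fin// mul1e.
Qed.
End TailHalf.
End TailProfiles.

(** * Nested norms over initial intervals *)

Section HeadProfiles.
Context {R : realType}.
Implicit Types (E F : fnorm R) (w b k : R -> R).

Definition headnorm E F b w k : \bar R :=
  tnorm E (@pos_line R)
    (fun t => (b t)%:E * tnorm F `]0%R, t[%classic (fun s => (w s * k s)%:E)).

Definition headtrunc E F b w (u : R) k : \bar R :=
  tnorm E `]u, +oo[%classic
    (fun t => (b t)%:E * tnorm F `]u, t[%classic (fun s => (w s * k s)%:E)).

(** If k is the K-functional of a couple, this is the K-functional of the
reversed couple. *)
Definition reflect_profile k (s : R) : R := (s * k s^-1)%R.

(** Chosen so that the product with the reflected profile is w k at the inverse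
point. *)
Definition reflect_weight w (s : R) : R := (s `^ (- 1) * w s^-1)%R.

Lemma reflect_quasiconcave k : quasiconcave k -> quasiconcave (reflect_profile k).
Proof.
move=> [k0 kmono kslope]; rewrite /reflect_profile; split => [s s0|s t s0 st|s t s0 st].
- by rewrite mulr_ge0 ?(ltW s0) ?k0 ?invr_gt0.
- have t0 := lt_le_trans s0 st.
  have := kslope t^-1%R s^-1%R; rewrite invr_gt0 lef_pV2 ?posrE// => /(_ t0 st) H.
  rewrite -(ler_pM2l (_ : 0 < t^-1 * s^-1)%R); last by rewrite mulr_gt0// invr_gt0.
  rewrite (_ : (_ * (s * _)) = t^-1 * k s^-1)%R; last by field; rewrite !gt_eqF.
  rewrite (_ : (_ * (t * _)) = s^-1 * k t^-1)%R; last by field; rewrite !gt_eqF.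
  exact: H.
- have t0 := lt_le_trans s0 st.
  rewrite mulrCA ler_pM2l// ler_pM2l//; apply: kmono; first by rewrite invr_gt0.
  by rewrite lef_pV2 ?posrE.
Qed.

Lemma reflect_weightP w (p q : R) : weight w p q ->
  weight (reflect_weight w) (- 1 - q) (- 1 - p).
Proof. by move=> hw; exact: weightM (weight_powR (-1)%R) (weight_inv hw). Qed.

Lemma reflect_mul w k (x : R) : (0 < x)%R ->
  (reflect_weight w x * reflect_profile k x = w x^-1 * k x^-1)%R.
Proof.
move=> x0; rewrite /reflect_weight /reflect_profile powR_inv1 ?ltW//.
by field; rewrite gt_eqF.
Qed.

Lemma nonneg_meas_inner_head F b (p q : R) (J : R -> set R) (h : R -> \bar R) : ri_space F ->
  weight b p q -> (forall s t : R, (s <= t)%R -> J s `<=` J t) ->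
  (forall x : R, (0 < x)%R -> 0 <= h x) ->
  nonneg_meas (fun t => (b t)%:E * tnorm F (J t) h).
Proof.
move=> hF hb JJ h0; apply: nonneg_measM; first exact: weight_nonneg_meas hb.
apply: nondecreasing_nonneg_meas => [s t _ st|t _]; last exact: tnorm_ge0.
apply: le_tnorm; first exact: hF.
move=> x x0 Jx; split; first exact: JJ Jx.
by rewrite h0// lexx.
Qed.

Section Reflection.
Variables (E F : fnorm R) (b w : R -> R) (pb qb pw qw : R).
Hypotheses (hE : ri_space E) (hF : ri_space F).
Hypotheses (hb : weight b pb qb) (hw : weight w pw qw).
Let b' s := b s^-1%R.
Let w' := reflect_weight w.
Let hb' : weight b' (- qb) (- pb) := weight_inv hb.
Let hw' : weight w' (- 1 - qw) (- 1 - pw) := reflect_weightP hw.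

Lemma terminal_normE (u : R) : (0 < u)%R ->
  tnorm E `]u, +oo[%classic (EFin \o b) = tnorm E `]0%R, u^-1%R[%classic (EFin \o b').
Proof.
move=> u0; rewrite tnorm_inv; [|exact: hE|exact: measurable_itv|exact: weight_nonneg_meas hb].
apply: eq_tnorm => x x0; split => //=; rewrite !in_itv/= x0 andbT/=.
by rewrite -[in X in _ <-> X](invrK x) ltf_pV2 ?posrE ?invr_gt0.
Qed.

(** Inversion exchanges (0, t) and (1/t, oo) and preserves dt/t. *)
Lemma headnormE k : quasiconcave k ->
  headnorm E F b w k = tailnorm E F b' w' (reflect_profile k).
Proof.
move=> hk; rewrite /headnorm tnorm_inv; [|exact: hE|exact: measurable_pos_line|]; last first.
  apply: (nonneg_meas_inner_head (J := fun t => `]0%R, t[%classic) hF hb); last exact: weight_mul_ge0 hw _ hk.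
  by move=> s t st x /=; rewrite !in_itv/= => /andP[-> xs]; rewrite (lt_le_trans xs).
apply: eq_tnorm => t t0 /=; rewrite !pos_lineE invr_gt0; split; [by []|move=> _; apply: (congr1 (mule _))].
rewrite tnorm_inv; [|exact: hF|exact: measurable_itv|exact: nonneg_meas_weight_mul hw _].
apply: eq_tnorm => x x0 /=; split; last by move=> _; rewrite reflect_mul.
by rewrite !in_itv/= invr_gt0 x0 andbT/= ltf_pV2 ?posrE.
Qed.

Lemma headtruncE (u : R) k : (0 < u)%R -> quasiconcave k ->
  headtrunc E F b w u k = tailtrunc E F b' w' u^-1 (reflect_profile k).
Proof.
move=> u0 hk; rewrite /headtrunc tnorm_inv; [|exact: hE|exact: measurable_itv|]; last first.
  apply: (nonneg_meas_inner_head (J := fun t => `]u, t[%classic) hF hb); last exact: weight_mul_ge0 hw _ hk.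
  by move=> s t st x /=; rewrite !in_itv/= => /andP[-> xs]; rewrite (lt_le_trans xs).
have inv_lt (x y : R) : (0 < x)%R -> (0 < y)%R -> (x < y^-1)%R = (y < x^-1)%R.
  by move=> x0 y0; rewrite -[in RHS](invrK y) ltf_pV2 ?posrE ?invr_gt0.
apply: eq_tnorm => t t0; split => [|_].
  by rewrite /= !in_itv/= t0 andbT/= (inv_lt t).
apply: (congr1 (mule _)).
rewrite tnorm_inv; [|exact: hF|exact: measurable_itv|exact: nonneg_meas_weight_mul hw _].
apply: eq_tnorm => x x0 /=; split; last by move=> _; rewrite reflect_mul.
by rewrite !in_itv/= (inv_lt x)// ltf_pV2 ?posrE// andbC.
Qed.

Lemma terminal_norm_gt0 (u : R) : (0 < u)%R -> 0 < tnorm E `]u, +oo[%classic (EFin \o b).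
Proof.
by move=> u0; rewrite (terminal_normE u0); apply: (initial_norm_gt0 hE hb'); rewrite invr_gt0.
Qed.

Lemma terminal_norm_fin (v u : R) : (0 < v)%R ->
  tnorm E `]v, +oo[%classic (EFin \o b) < +oo -> (0 < u)%R ->
  tnorm E `]u, +oo[%classic (EFin \o b) < +oo.
Proof.
move=> v0 Bv u0; rewrite (terminal_normE u0).
apply: (initial_norm_fin hE hb' (v := v^-1%R)); [by rewrite invr_gt0| |by rewrite invr_gt0].
by rewrite -(terminal_normE v0).
Qed.

Lemma headtrunc_le (u : R) k : (0 < u)%R -> quasiconcave k ->
  headtrunc E F b w u k <= headnorm E F b w k.
Proof.
move=> u0 hk; rewrite (headnormE hk) (headtruncE u0 hk).
by apply: (tailtrunc_le hE hF hb' hw'); exact: reflect_quasiconcave.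
Qed.

Lemma headtrunc_le_sum (u D : R) k k1 k2 : (0 < u)%R -> (0 <= D)%R ->
  quasiconcave k -> quasiconcave k1 -> quasiconcave k2 ->
  (forall s : R, (0 < s)%R -> (k s <= D * (k1 s + k2 s))%R) ->
  headtrunc E F b w u k <= D%:E * (headtrunc E F b w u k1 + headtrunc E F b w u k2).
Proof.
move=> u0 D0 hk hk1 hk2 hD; rewrite (headtruncE u0 hk) (headtruncE u0 hk1) (headtruncE u0 hk2).
apply: (tailtrunc_le_sum hE hF hb' hw' _ D0);
  [exact: reflect_quasiconcave|exact: reflect_quasiconcave|exact: reflect_quasiconcave|].
move=> s s0; rewrite /reflect_profile -mulrDr mulrCA ler_pM2l//; apply: hD.
by rewrite invr_gt0.
Qed.

Lemma headtrunc_le_terminal (u M : R) k : (0 < u)%R -> quasiconcave k -> (0 <= M)%R ->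
  tnorm F `]u, +oo[%classic (fun s => (w s * k s)%:E) <= M%:E ->
  headtrunc E F b w u k <= M%:E * tnorm E `]u, +oo[%classic (EFin \o b).
Proof.
move=> u0 hk M0 hM; rewrite (headtruncE u0 hk) (terminal_normE u0).
apply: (tailtrunc_le_initial hE hF hb' hw' (reflect_quasiconcave hk) M0).
move: hM; rewrite tnorm_inv; [|exact: hF|exact: measurable_itv|exact: nonneg_meas_weight_mul hw _].
rewrite (@eq_tnorm _ F _ `]0%R, u^-1%R[%classic _
  (fun s => (w' s * reflect_profile k s)%:E)); first exact.
move=> x x0 /=; split; last by move=> _; rewrite reflect_mul.
by rewrite !in_itv/= x0 andbT/= -[in X in _ <-> X](invrK x) ltf_pV2 ?posrE ?invr_gt0.
Qed.

Lemma headnorm_ge : exists2 C : R, (0 < C)%R &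
  forall (u : R) k, (0 < u)%R -> quasiconcave k ->
    (w u * k u)%:E * tnorm E `]u, +oo[%classic (EFin \o b) <= C%:E * headnorm E F b w k.
Proof.
have [C C0 hC] := tailnorm_ge hE hF hb' hw'.
exists C; first exact: C0.
move=> u k u0 hk; rewrite (terminal_normE u0) (headnormE hk).
have ui0 : (0 < u^-1)%R by rewrite invr_gt0.
have := hC _ _ ui0 (reflect_quasiconcave hk).
by rewrite (reflect_mul w k ui0) invrK.
Qed.

Hypotheses (pw_gt : (- 1 < pw)%R) (pwb_gt : (- 1 < pb + pw)%R).

(** Mirror image of [tailnorm_le_trunc]: the reflected profile stays below its
value at 1/u exactly when l(s)/s stays below k(u)/u. *)
Lemma headnorm_le_trunc : exists2 C : R, (0 < C)%R &
  forall (u D : R) k l, (0 < u)%R -> (0 <= D)%R -> quasiconcave k -> quasiconcave l ->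
    (forall s : R, (u <= s)%R -> (l s <= D * k s)%R) ->
    (forall s : R, (0 < s)%R -> (s <= u)%R -> (u * l s <= D * (s * k u))%R) ->
    headnorm E F b w l <= (C * D)%:E * headtrunc E F b w u k.
Proof.
have q0 : (- 1 - pw < 0)%R by rewrite subr_lt0.
have qb0 : (- pb + (- 1 - pw) < 0)%R by rewrite addrCA -opprD subr_lt0.
have [C C0 hC] := tailnorm_le_trunc hE hF hb' hw' q0 qb0.
exists C; first exact: C0.
move=> u D k l u0 D0 hk hl lk lu; rewrite (headtruncE u0 hk) (headnormE hl).
have ui0 : (0 < u^-1)%R by rewrite invr_gt0.
apply: (hC _ _ _ _ ui0 D0 (reflect_quasiconcave hk) (reflect_quasiconcave hl)).
- move=> s s0 su; rewrite /reflect_profile mulrCA ler_pM2l//; apply: lk.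
  by rewrite -(invrK u) lef_pV2 ?posrE.
- move=> s us; have s0 := lt_le_trans ui0 us.
  have := lu s^-1%R; rewrite invr_gt0 -[in X in _ -> X -> _](invrK u) lef_pV2 ?posrE//.
  move=> /(_ s0 us) H; rewrite /reflect_profile invrK.
  rewrite -(ler_pM2l (_ : 0 < u * s^-1)%R); last by rewrite mulr_gt0// invr_gt0.
  rewrite (_ : (_ * (s * _)) = u * l s^-1)%R; last by field; rewrite gt_eqF.
  rewrite (_ : (_ * (D * _)) = D * (s^-1 * k u))%R; first exact: H.
  by field; rewrite !gt_eqF.
Qed.
End Reflection.
End HeadProfiles.

(** * The K-functional *)

Section KFunctional.
Context {R : realType} {V : topologicalLmodType R}.

Section QuasiNorm.
Variables (X : qspace R V).
Hypothesis hX : quasi_banach_in X.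

Definition rnorm (Y : qspace R V) (x : V) : R := fine (qnorm Y x).

Lemma qnormE x : carrier X x -> qnorm X x = (rnorm X x)%:E.
Proof.
move=> Xx; rewrite /rnorm fineK// ge0_fin_numE ?(qb_fin hX)//.
exact: (qb_ge0 hX).
Qed.

Lemma rnorm_ge0 x : carrier X x -> (0 <= rnorm X x)%R.
Proof. by move=> Xx; rewrite -lee_fin -qnormE//; exact: (qb_ge0 hX). Qed.

Lemma rnorm0 : rnorm X 0%R = 0%R.
Proof.
have X0 := qb_0 hX.
by rewrite /rnorm -{1}(scale0r (0%R : V)) (qb_homo hX)// normr0 mul0e.
Qed.

Lemma carrierN x : carrier X x -> carrier X (- x)%R.
Proof. by move=> Xx; rewrite -scaleN1r; exact: qb_Z hX _ _ Xx. Qed.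

Lemma rnormN x : carrier X x -> rnorm X (- x)%R = rnorm X x.
Proof. by move=> Xx; rewrite /rnorm -scaleN1r (qb_homo hX)// normrN1 mul1e. Qed.

Lemma rnormD : exists2 C : R, (0 < C)%R & forall x y : V, carrier X x -> carrier X y ->
  (rnorm X (x + y)%R <= C * (rnorm X x + rnorm X y))%R.
Proof.
have [C hC] := qb_triangle hX; exists (`|C| + 1)%R; first by rewrite ltr_wpDl.
move=> x y Xx Xy; have := hC _ _ Xx Xy.
rewrite (qnormE (qb_D hX Xx Xy)) !qnormE// -EFinD -EFinM lee_fin => /le_trans; apply.
by rewrite ler_wpM2r ?addr_ge0 ?rnorm_ge0// (le_trans (ler_norm C))// lerDl.
Qed.
End QuasiNorm.

Variables (X0 X1 : qspace R V).
Hypotheses (hX0 : quasi_banach_in X0) (hX1 : quasi_banach_in X1).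

Definition Kreal (f : V) (s : R) : R := fine (Kfun X0 X1 s f).

Lemma KfunE f s : sum_space X0 X1 f -> (0 < s)%R -> Kfun X0 X1 s f = (Kreal f s)%:E.
Proof.
move=> [f0 [f1 [Xf0 Xf1 ->]]] s0; rewrite fineK// ge0_fin_numE; last first.
  apply/ereal_infP => _ [g0 [g1 [Xg0 Xg1 _ ->]]].
  by rewrite (qnormE hX0)// (qnormE hX1)// -EFinM -EFinD lee_fin addr_ge0 ?mulr_ge0 ?rnorm_ge0 ?(ltW s0).
apply: (@le_lt_trans _ _ (rnorm X0 f0 + s * rnorm X1 f1)%:E); last exact: ltry.
apply: ge_ereal_inf; exists (rnorm X0 f0 + s * rnorm X1 f1)%:E => //.
by exists f0, f1; split => //; rewrite (qnormE hX0)// (qnormE hX1)// -EFinM -EFinD.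
Qed.

Lemma Kreal_le f f0 f1 s : carrier X0 f0 -> carrier X1 f1 -> f = (f0 + f1)%R -> (0 < s)%R ->
  (Kreal f s <= rnorm X0 f0 + s * rnorm X1 f1)%R.
Proof.
move=> Xf0 Xf1 fE s0; rewrite -lee_fin -KfunE//; last by exists f0, f1.
apply: ge_ereal_inf; exists (rnorm X0 f0 + s * rnorm X1 f1)%:E => //.
by exists f0, f1; split => //; rewrite (qnormE hX0)// (qnormE hX1)// -EFinM -EFinD.
Qed.

Lemma Kreal_ge f s (c : R) : sum_space X0 X1 f -> (0 < s)%R ->
  (forall f0 f1, carrier X0 f0 -> carrier X1 f1 -> f = (f0 + f1)%R ->
    (c <= rnorm X0 f0 + s * rnorm X1 f1)%R) -> (c <= Kreal f s)%R.
Proof.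
move=> Sf s0 hc; rewrite -lee_fin -KfunE//; apply/ereal_infP => _ [f0 [f1 [Xf0 Xf1 fE ->]]].
by rewrite (qnormE hX0)// (qnormE hX1)// -EFinM -EFinD lee_fin hc.
Qed.

Lemma Kreal_near f s (c : R) : sum_space X0 X1 f -> (0 < s)%R -> (Kreal f s < c)%R ->
  exists f0 f1, [/\ carrier X0 f0, carrier X1 f1, f = (f0 + f1)%R &
    (rnorm X0 f0 + s * rnorm X1 f1 < c)%R].
Proof.
move=> Sf s0 kc; apply: contrapT => H; move: kc; rewrite ltNge => /negP; apply.
apply: Kreal_ge => // f0 f1 Xf0 Xf1 fE; rewrite leNgt; apply/negP => lt.
by apply: H; exists f0, f1.
Qed.

Lemma Kreal_quasiconcave f : sum_space X0 X1 f -> quasiconcave (Kreal f).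
Proof.
move=> Sf; split => [s s0|s t s0 st|s t s0 st].
- apply: Kreal_ge => // f0 f1 Xf0 Xf1 _.
  by rewrite addr_ge0 ?mulr_ge0 ?rnorm_ge0 ?(ltW s0).
- apply: Kreal_ge => //; first exact: lt_le_trans st.
  move=> f0 f1 Xf0 Xf1 fE; apply: le_trans (Kreal_le Xf0 Xf1 fE s0) _.
  by rewrite lerD2l ler_wpM2r// rnorm_ge0.
- have t0 := lt_le_trans s0 st.
  rewrite -ler_pdivrMl//; apply: Kreal_ge => // f0 f1 Xf0 Xf1 fE.
  rewrite ler_pdivrMl//.
  have := Kreal_le Xf0 Xf1 fE t0; rewrite -(ler_pM2l s0) => /le_trans; apply.
  have n0 := rnorm_ge0 hX0 Xf0; rewrite !mulrDr (mulrCA s t) lerD2r.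
  by rewrite ler_wpM2r.
Qed.

Lemma sum_spaceD f g : sum_space X0 X1 f -> sum_space X0 X1 g -> sum_space X0 X1 (f + g)%R.
Proof.
move=> [f0 [f1 [Xf0 Xf1 ->]]] [g0 [g1 [Xg0 Xg1 ->]]].
exists (f0 + g0)%R, (f1 + g1)%R; split; [exact: qb_D hX0 _ _ Xf0 Xg0|exact: qb_D hX1 _ _ Xf1 Xg1|].
by rewrite addrACA.
Qed.

Lemma sum_spaceN f : sum_space X0 X1 f -> sum_space X0 X1 (- f)%R.
Proof.
move=> [f0 [f1 [Xf0 Xf1 ->]]]; exists (- f0)%R, (- f1)%R.
by split; [exact: carrierN|exact: carrierN|rewrite opprD].
Qed.

Lemma KrealN f s : sum_space X0 X1 f -> (0 < s)%R -> (Kreal (- f) s <= Kreal f s)%R.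
Proof.
move=> Sf s0; apply: Kreal_ge => // f0 f1 Xf0 Xf1 fE.
rewrite -(rnormN hX0)// -(rnormN hX1)//.
by apply: Kreal_le => //; [exact: carrierN|exact: carrierN|rewrite fE opprD].
Qed.

Lemma KrealD : exists2 C : R, (0 < C)%R & forall f g s, sum_space X0 X1 f -> sum_space X0 X1 g ->
  (0 < s)%R -> (Kreal (f + g) s <= C * (Kreal f s + Kreal g s))%R.
Proof.
have [C C0 hC] := rnormD hX0; have [D D0 hD] := rnormD hX1.
exists (C + D)%R => [|f g s Sf Sg s0]; first exact: addr_gt0.
have CD : (0 < C + D)%R by exact: addr_gt0.
rewrite -ler_pdivrMl// -lerBlDr; apply: Kreal_ge => // f0 f1 Xf0 Xf1 fE.
rewrite lerBlDr (addrC _ (Kreal g s)) -lerBlDr; apply: Kreal_ge => // g0 g1 Xg0 Xg1 gE.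
rewrite lerBlDr ler_pdivrMl//.
have XD0 := qb_D hX0 Xf0 Xg0; have XD1 := qb_D hX1 Xf1 Xg1.
have fgE : (f + g = (f0 + g0) + (f1 + g1))%R by rewrite fE gE addrACA.
apply: (le_trans (Kreal_le XD0 XD1 fgE s0)).
have a0 := rnorm_ge0 hX0 Xf0; have b0 := rnorm_ge0 hX0 Xg0.
have a1 := rnorm_ge0 hX1 Xf1; have b1 := rnorm_ge0 hX1 Xg1.
have h0 := hC _ _ Xf0 Xg0; have h1 := hD _ _ Xf1 Xg1.
apply: (@le_trans _ _ (C * (rnorm X0 f0 + rnorm X0 g0) + s * (D * (rnorm X1 f1 + rnorm X1 g1)))%R).
  by apply: lerD => //; rewrite ler_wpM2l// ltW.
have p0 : (0 <= D * (rnorm X0 f0 + rnorm X0 g0))%R by rewrite mulr_ge0 ?addr_ge0// ltW.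
have p1 : (0 <= C * (s * (rnorm X1 f1 + rnorm X1 g1)))%R.
  by rewrite !mulr_ge0 ?addr_ge0// ltW.
lra.
Qed.

Lemma Kreal_carrier0 f s : carrier X0 f -> (0 < s)%R -> (Kreal f s <= rnorm X0 f)%R.
Proof.
move=> Xf s0; have fE : f = (f + 0)%R by rewrite addr0.
by have := Kreal_le Xf (qb_0 hX1) fE s0; rewrite (rnorm0 hX1) mulr0 addr0.
Qed.

Lemma Kreal_carrier1 f s : carrier X1 f -> (0 < s)%R -> (Kreal f s <= s * rnorm X1 f)%R.
Proof.
move=> Xf s0; have fE : f = (0 + f)%R by rewrite add0r.
by have := Kreal_le (qb_0 hX0) Xf fE s0; rewrite (rnorm0 hX0) add0r.
Qed.

Lemma sum_space_carrier0 f : carrier X0 f -> sum_space X0 X1 f.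
Proof. by move=> Xf; exists f, 0%R; split; [|exact: qb_0 hX1|rewrite addr0]. Qed.

Lemma sum_space_carrier1 f : carrier X1 f -> sum_space X0 X1 f.
Proof. by move=> Xf; exists 0%R, f; split; [exact: qb_0 hX0| |rewrite add0r]. Qed.

(** If the K-functional is positive at u, a decomposition that is optimal up to
a factor 2 works. If it vanishes at u, it vanishes everywhere by monotonicity
of K(s) and K(s)/s, and f + 0 works. *)
Lemma Kreal_split f u : sum_space X0 X1 f -> (0 < u)%R ->
  exists f0 f1, [/\ sum_space X0 X1 f0, sum_space X0 X1 f1, f = (f0 + f1)%R,
    forall s, (0 < s)%R -> (Kreal f0 s <= 2 * Kreal f u)%R &
    forall s, (0 < s)%R -> (u * Kreal f1 s <= 2 * (s * Kreal f u))%R].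
Proof.
move=> Sf u0; have qf := Kreal_quasiconcave Sf.
have := qc_ge0 qf u0; rewrite le_eqVlt => /predU1P[ku|ku]; last first.
  have k2 : (Kreal f u < 2 * Kreal f u)%R by lra.
  have [f0 [f1 [Xf0 Xf1 fE lt2]]] := Kreal_near Sf u0 k2.
  have n0 := rnorm_ge0 hX0 Xf0; have n1 := rnorm_ge0 hX1 Xf1.
  have un1 : (0 <= u * rnorm X1 f1)%R by rewrite mulr_ge0// ltW.
  exists f0, f1; split => // [||s s0|s s0].
  - exact: sum_space_carrier0.
  - exact: sum_space_carrier1.
  - by apply: (le_trans (Kreal_carrier0 Xf0 s0)); lra.
  - apply: (@le_trans _ _ (u * (s * rnorm X1 f1))%R).
      by rewrite ler_pM2l//; exact: Kreal_carrier1.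
    by rewrite mulrCA [leRHS]mulrCA ler_pM2l//; lra.
have S0 : sum_space X0 X1 0%R by apply: sum_space_carrier0; exact: qb_0 hX0.
exists f, 0%R; split => // [|s s0|s s0]; first by rewrite addr0.
  rewrite -ku mulr0; have [su|us] := leP s u.
    by rewrite ku; exact: qc_mono.
  by have := qc_slope qf u0 (ltW us); rewrite -ku mulr0 pmulr_rle0.
rewrite -ku !mulr0 pmulr_rle0//; apply: (le_trans (Kreal_carrier0 (qb_0 hX0) s0)).
by rewrite (rnorm0 hX0).
Qed.
End KFunctional.

(** * Estimates across the two scales *)

Section CrossEstimates.
Context {R : realType}.
Variables (E0 E1 F0 F1 : fnorm R) (b0 b1 w0 w1 : R -> R).
Variables (r0 s0 r1 s1 p0 q0 p1 q1 : R).
Hypotheses (hE0 : ri_space E0) (hE1 : ri_space E1).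
Hypotheses (hF0 : ri_space F0) (hF1 : ri_space F1).
Hypotheses (hb0 : weight b0 r0 s0) (hb1 : weight b1 r1 s1).
Hypotheses (hw0 : weight w0 p0 q0) (hw1 : weight w1 p1 q1).
Hypothesis qp : (q1 < p0)%R.
Variables (B0 B1 : R -> R).
Hypothesis B0E : forall u : R, (0 < u)%R ->
  tnorm E0 `]0%R, u[%classic (EFin \o b0) = (B0 u)%:E.
Hypothesis B1E : forall u : R, (0 < u)%R ->
  tnorm E1 `]u, +oo[%classic (EFin \o b1) = (B1 u)%:E.

Lemma initial_real_norm_gt0 u : (0 < u)%R -> (0 < B0 u)%R.
Proof. by move=> u0; rewrite -lte_fin -(B0E u0); exact: initial_norm_gt0 hE0 hb0 _ u0. Qed.

Lemma terminal_real_norm_gt0 u : (0 < u)%R -> (0 < B1 u)%R.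
Proof. by move=> u0; rewrite -lte_fin -(B1E u0); exact: terminal_norm_gt0 hE1 hb1 _ u0. Qed.

Lemma initial_real_norm_mono u v : (0 < u)%R -> (u <= v)%R -> (B0 u <= B0 v)%R.
Proof.
move=> u0 uv; have v0 := lt_le_trans u0 uv.
by rewrite -lee_fin -(B0E u0) -(B0E v0); exact: initial_norm_mono hE0 hb0 _ _ uv.
Qed.

Lemma terminal_real_norm_anti u v : (0 < u)%R -> (u <= v)%R -> (B1 v <= B1 u)%R.
Proof.
move=> u0 uv; have v0 := lt_le_trans u0 uv.
rewrite -lee_fin -(B1E u0) -(B1E v0); apply: le_tnorm; first exact: hE1.
move=> x x0 /=; rewrite !in_itv/= !andbT => vx; split; first exact: le_lt_trans vx.
by rewrite lexx lee_fin ltW// (weight_gt0 hb1).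
Qed.

(** The full norm of type L bounds w1(s) k(s) B1(s) at each s < u, where
B1(s) is at least B1(u). This leaves the ratio w0/w1, which has a positive
index because th0 < th1, and whose norm over (0, u) is comparable with its
value at u. *)
Lemma tailtrunc_le_headnorm : exists2 C : R, (0 < C)%R &
  forall (u n : R) k, (0 < u)%R -> (0 <= n)%R -> quasiconcave k ->
    headnorm E1 F1 b1 w1 k <= n%:E ->
    tailtrunc E0 F0 b0 w0 u k <= (C * ((w0 u * B0 u) / (w1 u * B1 u)) * n)%:E.
Proof.
have w00 := weight_gt0 hw0; have w10 := weight_gt0 hw1.
have hr := weightM hw0 (weightV hw1).
have pr : (0 < p0 + - q1)%R by rewrite subr_gt0.
have [C C0 hC] := weight_tnorm_initial hF0 hr pr.
have [D D0 hD] := headnorm_ge hE1 hF1 hb1 hw1.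
exists (C * D)%R => [|u n k u0 n0 hk kn]; first exact: mulr_gt0.
have b00 := initial_real_norm_gt0 u0; have b10 := terminal_real_norm_gt0 u0.
have wu0 := w00 _ u0; have wu1 := w10 _ u0.
have kle (s : R) : (0 < s)%R -> (s <= u)%R -> (w1 s * k s <= D * n / B1 u)%R.
  move=> s0' su; rewrite ler_pdivlMr//.
  have ws : (0 <= w1 s * k s)%R by rewrite mulr_ge0 ?(qc_ge0 hk)// ltW// w10.
  apply: (@le_trans _ _ (w1 s * k s * B1 s)%R).
    by rewrite ler_wpM2l// terminal_real_norm_anti.
  rewrite -lee_fin EFinM -(B1E s0').
  apply: (le_trans (hD _ _ s0' hk)); rewrite EFinM; apply: lee_wpmul2l_fin kn; exact: ltW.
pose M := (D * n / B1 u * (C * (w0 u * (w1 u)^-1)))%R.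
have M0 : (0 <= M)%R.
  by rewrite mulr_ge0 ?divr_ge0 ?mulr_ge0 ?invr_ge0 ?n0 ?(ltW C0) ?(ltW D0) ?(ltW b10) ?(ltW wu0) ?(ltW wu1).
have H : tnorm F0 `]0%R, u[%classic (fun s => (w0 s * k s)%:E) <= M%:E.
  apply: (tnorm_le_cst (J := `]0%R, u[%classic) (g := fun s => w0 s * (w1 s)^-1)%R);
    [exact: hF0|exact: measurable_itv| |exact: weight_nonneg_meas hr| |exact: hC].
    by rewrite divr_ge0 ?mulr_ge0 ?n0 ?(ltW D0) ?(ltW b10).
  move=> s s0' su; split; first exact: su.
  apply/andP; split; first exact: weight_mul_ge0 hw0 _ hk _ s0'.
  have su' : (s <= u)%R by move: su; rewrite /= in_itv/= => /andP[_ /ltW].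
  rewrite lee_fin mulrCA ler_pM2l ?w00// ler_pdivlMr ?w10// mulrC; exact: kle.
apply: (le_trans (tailtrunc_le_initial hE0 hF0 hb0 hw0 hk M0 H)).
rewrite (B0E u0) -EFinM lee_fin le_eqVlt; apply/orP; left; apply/eqP.
by rewrite /M; field; rewrite !gt_eqF.
Qed.

(** As [tailtrunc_le_headnorm], with s > u, B0(s) at least B0(u), and the ratio
w1/w0 of negative index. *)
Lemma headtrunc_le_tailnorm : exists2 C : R, (0 < C)%R &
  forall (u n : R) k, (0 < u)%R -> (0 <= n)%R -> quasiconcave k ->
    tailnorm E0 F0 b0 w0 k <= n%:E ->
    headtrunc E1 F1 b1 w1 u k <= (C * ((w1 u * B1 u) / (w0 u * B0 u)) * n)%:E.
Proof.
have w00 := weight_gt0 hw0; have w10 := weight_gt0 hw1.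
have hr := weightM hw1 (weightV hw0).
have pr : (q1 + - p0 < 0)%R by rewrite subr_lt0.
have [C C0 hC] := weight_tnorm_tail hF1 hr pr.
have [D D0 hD] := tailnorm_ge hE0 hF0 hb0 hw0.
exists (C * D)%R => [|u n k u0 n0 hk kn]; first exact: mulr_gt0.
have b00 := initial_real_norm_gt0 u0; have b10 := terminal_real_norm_gt0 u0.
have wu0 := w00 _ u0; have wu1 := w10 _ u0.
have kle (s : R) : (u <= s)%R -> (w0 s * k s <= D * n / B0 u)%R.
  move=> us; have s0' := lt_le_trans u0 us; rewrite ler_pdivlMr//.
  have ws : (0 <= w0 s * k s)%R by rewrite mulr_ge0 ?(qc_ge0 hk)// ltW// w00.
  apply: (@le_trans _ _ (w0 s * k s * B0 s)%R).
    by rewrite ler_wpM2l// initial_real_norm_mono.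
  rewrite -lee_fin EFinM -(B0E s0').
  apply: (le_trans (hD _ _ s0' hk)); rewrite EFinM; apply: lee_wpmul2l_fin kn; exact: ltW.
pose M := (D * n / B0 u * (C * (w1 u * (w0 u)^-1)))%R.
have M0 : (0 <= M)%R.
  by rewrite mulr_ge0 ?divr_ge0 ?mulr_ge0 ?invr_ge0 ?n0 ?(ltW C0) ?(ltW D0) ?(ltW b00) ?(ltW wu0) ?(ltW wu1).
have H : tnorm F1 `]u, +oo[%classic (fun s => (w1 s * k s)%:E) <= M%:E.
  apply: (tnorm_le_cst (J := `[u, +oo[%classic) (g := fun s => w1 s * (w0 s)^-1)%R);
    [exact: hF1|exact: measurable_itv| |exact: weight_nonneg_meas hr| |exact: hC].
    by rewrite divr_ge0 ?mulr_ge0 ?n0 ?(ltW D0) ?(ltW b00).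
  move=> s s0'; rewrite /= !in_itv/= !andbT => /ltW us; split; first exact: us.
  apply/andP; split; first exact: weight_mul_ge0 hw1 _ hk _ s0'.
  rewrite lee_fin mulrCA ler_pM2l ?w10// ler_pdivlMr ?w00// mulrC; exact: kle.
apply: (le_trans (headtrunc_le_terminal hE1 hF1 hb1 hw1 u0 hk M0 H)).
rewrite (B1E u0) -EFinM lee_fin le_eqVlt; apply/orP; left; apply/eqP.
by rewrite /M; field; rewrite !gt_eqF.
Qed.
End CrossEstimates.

(** * The two inequalities *)

Lemma ge0_lty_real {R : realType} (x : \bar R) : 0 <= x -> x < +oo ->
  exists2 r : R, (0 <= r)%R & x = r%:E.
Proof. by case: x => [r| |]//; rewrite lee_fin => r0 _; exists r. Qed.

Section SpaceNorms.
Context {R : realType} {V : topologicalLmodType R}.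
Variables (X0 X1 : qspace R V).
Hypotheses (hX0 : quasi_banach_in X0) (hX1 : quasi_banach_in X1).
Variables (th : R) (a b : R -> R) (E F : fnorm R).

Let w s := (s `^ (- th) * a s)%R.

Lemma wKE f s : sum_space X0 X1 f -> (0 < s)%R ->
  wK X0 X1 th a f s = (w s * Kreal X0 X1 f s)%:E.
Proof. by move=> Sf s0; rewrite /wK (KfunE hX0 hX1 Sf s0) EFinM. Qed.

Lemma eq_nested_norm (I : set R) (J : R -> set R) f : sum_space X0 X1 f ->
  tnorm E I (fun t => (b t)%:E * tnorm F (J t) (wK X0 X1 th a f)) =
  tnorm E I (fun t => (b t)%:E * tnorm F (J t) (fun s => (w s * Kreal X0 X1 f s)%:E)).
Proof.
move=> Sf; apply: eq_tnorm => t t0; split; first by [].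
move=> _; apply: (congr1 (mule _)); apply: eq_tnorm => s s0; split; first by [].
by move=> _; exact: wKE.
Qed.

Lemma XR_normE f : sum_space X0 X1 f ->
  XR_norm X0 X1 th b E a F f = tailnorm E F b w (Kreal X0 X1 f).
Proof. exact: eq_nested_norm. Qed.

Lemma XL_normE f : sum_space X0 X1 f ->
  XL_norm X0 X1 th b E a F f = headnorm E F b w (Kreal X0 X1 f).
Proof. exact: eq_nested_norm. Qed.
End SpaceNorms.

Section Holmstedt.
Context {R : realType} {V : topologicalLmodType R}.
Variables (X0 X1 : qspace R V).
Hypotheses (hX0 : quasi_banach_in X0) (hX1 : quasi_banach_in X1).
Variables (th0 th1 e : R) (E0 E1 F0 F1 : fnorm R) (a0 a1 b0 b1 : R -> R).
Hypotheses (hE0 : ri_space E0) (hE1 : ri_space E1).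
Hypotheses (hF0 : ri_space F0) (hF1 : ri_space F1).
Hypotheses (ha0 : weight a0 (- e) e) (ha1 : weight a1 (- e) e).
Hypotheses (hb0 : weight b0 (- e) e) (hb1 : weight b1 (- e) e).
Hypotheses (e0 : (0 < e)%R) (eth0 : (2 * e < th0)%R).
Hypotheses (eth1 : (2 * e < 1 - th1)%R) (eth : (2 * e < th1 - th0)%R).
Variables (B0 B1 : R -> R).
Hypothesis B0E : forall u : R, (0 < u)%R ->
  tnorm E0 `]0%R, u[%classic (EFin \o b0) = (B0 u)%:E.
Hypothesis B1E : forall u : R, (0 < u)%R ->
  tnorm E1 `]u, +oo[%classic (EFin \o b1) = (B1 u)%:E.

Let w0 s := (s `^ (- th0) * a0 s)%R.
Let w1 s := (s `^ (- th1) * a1 s)%R.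
Let hw0 : weight w0 (- th0 + - e) (- th0 + e) := weightM (weight_powR (- th0)) ha0.
Let hw1 : weight w1 (- th1 + - e) (- th1 + e) := weightM (weight_powR (- th1)) ha1.
Let k f := Kreal X0 X1 f.
Let YR := XR_space X0 X1 th0 b0 E0 a0 F0.
Let YL := XL_space X0 X1 th1 b1 E1 a1 F1.
Let P u f := tailtrunc E0 F0 b0 w0 u (k f).
Let Q u f := headtrunc E1 F1 b1 w1 u (k f).
Let r u := ((w0 u * B0 u) / (w1 u * B1 u))%R.

Lemma rho_weight_gt0 u : (0 < u)%R -> (0 < r u)%R.
Proof.
move=> u0; have B00 := initial_real_norm_gt0 hE0 hb0 B0E u0; have B10 := terminal_real_norm_gt0 hE1 hb1 B1E u0.
by rewrite divr_gt0// mulr_gt0// ?(weight_gt0 hw0) ?(weight_gt0 hw1).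
Qed.

(** On its own side of u each piece is controlled through f minus the other
piece, on the far side through the near-optimality of the decomposition. *)
Lemma Kfun_le_truncated : exists2 C : R, (0 < C)%R & forall f u,
  sum_space X0 X1 f -> (0 < u)%R ->
  Kfun YR YL (r u) f <= C%:E * (P u f + (r u)%:E * Q u f).
Proof.
move: e0 eth0 eth1 => he he0 he1.
have q0 : (- th0 + e < 0)%R by lra.
have qb0 : (e + (- th0 + e) < 0)%R by lra.
have p1 : (- 1 < - th1 + - e)%R by lra.
have pb1 : (- 1 < - e + (- th1 + - e))%R by lra.
have [C0 C00 hC0] := tailnorm_le_trunc hE0 hF0 hb0 hw0 q0 qb0.
have [C1 C10 hC1] := headnorm_le_trunc hE1 hF1 hb1 hw1 p1 pb1.
have [C Cgt0 hC] := KrealD hX0 hX1.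
(* 3 C on the near side, where k f + 2 k f enters the quasi-triangle
   inequality; 2 on the far side *)
pose D := (3 * C + 2)%R.
have D0 : (0 < D)%R by rewrite /D; lra.
have C0D : (0 <= C0 * D)%R by rewrite ltW// mulr_gt0.
have C1D : (0 <= C1 * D)%R by rewrite ltW// mulr_gt0.
have C0le : (C0 * D)%:E <= ((C0 + C1) * D)%:E by rewrite lee_fin ler_pM2r// lerDl ltW.
have C1le : (C1 * D)%:E <= ((C0 + C1) * D)%:E by rewrite lee_fin ler_pM2r// lerDr ltW.
have CD_gt0 : (0 < (C0 + C1) * D)%R by rewrite mulr_gt0// addr_gt0.
have CD0 := ltW CD_gt0.
exists ((C0 + C1) * D)%R => [|f u Sf u0]; first exact: CD_gt0.
have ru0 := rho_weight_gt0 u0.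
have P0 : 0 <= P u f by exact: tnorm_ge0.
have Q0 : 0 <= Q u f by exact: tnorm_ge0.
(* finiteness of the right-hand side is what puts f0 and f1 into the spaces *)
have [PQ|PQfin] := eqVneq (P u f + (r u)%:E * Q u f) +oo.
  by rewrite PQ gt0_muley ?leey// lte_fin mulr_gt0// addr_gt0.
have [f0 [f1 [Sf0 Sf1 fE kf0 kf1]]] := Kreal_split hX0 hX1 Sf u0.
have qf := Kreal_quasiconcave hX0 hX1 Sf.
have qf0 := Kreal_quasiconcave hX0 hX1 Sf0.
have qf1 := Kreal_quasiconcave hX0 hX1 Sf1.
have kf_ge0 s : (0 < s)%R -> (0 <= k f s)%R by exact: qc_ge0.
have kf0_le s : (0 < s)%R -> (k f0 s <= C * (k f s + k f1 s))%R.
  move=> s0; have f0E : f0 = (f + - f1)%R by rewrite fE addrK.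
  rewrite /k {1}f0E; apply: (le_trans (hC _ _ _ Sf (sum_spaceN hX0 hX1 Sf1) s0)).
  by rewrite ler_pM2l// lerD2l; exact: KrealN.
have kf1_le s : (0 < s)%R -> (k f1 s <= C * (k f s + k f0 s))%R.
  move=> s0; have f1E : f1 = (f + - f0)%R by rewrite fE addrC addrA addNr add0r.
  rewrite /k {1}f1E; apply: (le_trans (hC _ _ _ Sf (sum_spaceN hX0 hX1 Sf0) s0)).
  by rewrite ler_pM2l// lerD2l; exact: KrealN.
have N0 : tailnorm E0 F0 b0 w0 (k f0) <= (C0 * D)%:E * P u f.
  apply: (hC0 _ _ _ _ u0 (ltW D0) qf qf0) => [s s0 su|s us].
    have h : (k f1 s <= 2 * k f s)%R.
      rewrite -(ler_pM2l u0); apply: (le_trans (kf1 _ s0)); rewrite [leRHS]mulrCA ler_pM2l//.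
      exact: (qc_slope qf).
    apply: (le_trans (kf0_le _ s0)); apply: (@le_trans _ _ (C * (3 * k f s))%R).
      by rewrite ler_pM2l//; lra.
    have := kf_ge0 _ s0; rewrite /D /k; lra.
  have s0 := lt_le_trans u0 us.
  apply: (le_trans (kf0 _ s0)); rewrite ler_wpM2r//; first exact: kf_ge0.
  by rewrite /D; lra.
have N1 : headnorm E1 F1 b1 w1 (k f1) <= (C1 * D)%:E * Q u f.
  apply: (hC1 _ _ _ _ u0 (ltW D0) qf qf1) => [s us|s s0 su].
    have s0 := lt_le_trans u0 us.
    have h : (k f0 s <= 2 * k f s)%R.
      by apply: (le_trans (kf0 _ s0)); rewrite ler_pM2l//; exact: (qc_mono qf).
    apply: (le_trans (kf1_le _ s0)); apply: (@le_trans _ _ (C * (3 * k f s))%R).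
      by rewrite ler_pM2l//; lra.
    have := kf_ge0 _ s0; rewrite /D /k; lra.
  apply: (le_trans (kf1 _ s0)); rewrite ler_wpM2r//.
    by rewrite mulr_ge0 ?(ltW s0)//; exact: kf_ge0.
  by rewrite /D; lra.
have Pfin : P u f < +oo.
  rewrite ltey; apply: contra_neq PQfin => ->; rewrite addye// gt_eqF//.
  by apply: (lt_le_trans ltNy0); rewrite mule_ge0// lee_fin ltW.
have Qfin : Q u f < +oo.
  rewrite ltey; apply: contra_neq PQfin => ->; rewrite gt0_muley ?lte_fin// addey//.
  by rewrite gt_eqF//; apply: (lt_le_trans ltNy0).
have XRf0 : qnorm YR f0 = tailnorm E0 F0 b0 w0 (k f0) := XR_normE hX0 hX1 th0 a0 b0 E0 F0 Sf0.
have XLf1 : qnorm YL f1 = headnorm E1 F1 b1 w1 (k f1) := XL_normE hX0 hX1 th1 a1 b1 E1 F1 Sf1.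
have Y0fin : qnorm YR f0 < +oo.
  rewrite XRf0; apply: (le_lt_trans N0).
  by apply: lte_mul_pinfty; [rewrite lee_fin; exact: C0D|exact: erefl|exact: Pfin].
have Y1fin : qnorm YL f1 < +oo.
  rewrite XLf1; apply: (le_lt_trans N1).
  by apply: lte_mul_pinfty; [rewrite lee_fin; exact: C1D|exact: erefl|exact: Qfin].
have YRf0 : carrier YR f0 := conj Sf0 Y0fin.
have YLf1 : carrier YL f1 := conj Sf1 Y1fin.
apply: ge_ereal_inf; exists (qnorm YR f0 + (r u)%:E * qnorm YL f1).
  by exists f0, f1; split; [exact: YRf0|exact: YLf1|exact: fE|].
rewrite XRf0 XLf1.
have rQ0 : 0 <= (r u)%:E * Q u f by apply: mule_ge0; [rewrite lee_fin; exact: ltW|exact: Q0].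
rewrite ge0_muleDr; [|exact: P0|exact: rQ0].
apply: leeD.
  by apply: (le_trans N0); apply: lee_wpmul2r; [exact: P0|exact: C0le].
rewrite muleCA; apply: lee_wpmul2l_fin; first exact: ltW.
by apply: (le_trans N1); apply: lee_wpmul2r; [exact: Q0|exact: C1le].
Qed.

(** Each of the two truncated norms of f is split along an arbitrary
decomposition; the cross terms carry the factors rho(u) and 1/rho(u) that
match the weights of the sum. *)
Lemma truncated_le_Kfun : exists2 C : R, (0 < C)%R & forall f u,
  sum_space X0 X1 f -> (0 < u)%R ->
  P u f + (r u)%:E * Q u f <= C%:E * Kfun YR YL (r u) f.
Proof.
have qp : (- th1 + e < - th0 + - e)%R by move: eth => he; lra.
have [C0 C00 hC0] := tailtrunc_le_headnorm hE0 hE1 hF0 hF1 hb0 hb1 hw0 hw1 qp B0E B1E.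
have [C1 C10 hC1] := headtrunc_le_tailnorm hE0 hE1 hF0 hF1 hb0 hb1 hw0 hw1 qp B0E B1E.
have [C Cgt0 hC] := KrealD hX0 hX1.
pose D := (C * (1 + C0 + C1))%R.
have D0 : (0 < D)%R by rewrite /D mulr_gt0// !addr_gt0.
have num (x n0 n1 : R) : (0 < x)%R -> (0 <= n0)%R -> (0 <= n1)%R ->
    (C * (n0 + C0 * x * n1) + x * (C * (C1 * x^-1 * n0 + n1)) <= D * (n0 + x * n1))%R.
  move=> x0 n00 n10; rewrite /D.
  rewrite (_ : (C * (n0 + _) + _) = C * ((1 + C1) * n0 + (1 + C0) * (x * n1)))%R; last first.
    by field; rewrite gt_eqF.
  rewrite -mulrA ler_pM2l// mulrDr; apply: lerD; apply: ler_wpM2r => //.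
  - by rewrite lerD2r lerDl ltW.
  - by rewrite mulr_ge0// ltW.
  - by rewrite lerDl ltW.
exists D => [|f u Sf u0]; first exact: D0.
have ru0 := rho_weight_gt0 u0.
have B00 := initial_real_norm_gt0 hE0 hb0 B0E u0; have B10 := terminal_real_norm_gt0 hE1 hb1 B1E u0.
have wu0 := weight_gt0 hw0 u0; have wu1 := weight_gt0 hw1 u0.
rewrite -lee_pdivrMl; last by [].
apply/ereal_infP => _ [f0 [f1 [Y0 Y1 fE ->]]].
rewrite lee_pdivrMl; last by [].
have [Sf0 Y0fin] := Y0; have [Sf1 Y1fin] := Y1.
have XRf0 : qnorm YR f0 = tailnorm E0 F0 b0 w0 (k f0) := XR_normE hX0 hX1 th0 a0 b0 E0 F0 Sf0.
have XLf1 : qnorm YL f1 = headnorm E1 F1 b1 w1 (k f1) := XL_normE hX0 hX1 th1 a1 b1 E1 F1 Sf1.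
have N0fin : tailnorm E0 F0 b0 w0 (k f0) < +oo by rewrite -XRf0; exact: Y0fin.
have N1fin : headnorm E1 F1 b1 w1 (k f1) < +oo by rewrite -XLf1; exact: Y1fin.
rewrite XRf0 XLf1.
have qf := Kreal_quasiconcave hX0 hX1 Sf.
have qf0 := Kreal_quasiconcave hX0 hX1 Sf0.
have qf1 := Kreal_quasiconcave hX0 hX1 Sf1.
have kD s : (0 < s)%R -> (k f s <= C * (k f0 s + k f1 s))%R.
  by move=> s0; rewrite /k fE; exact: hC.
have hP := tailtrunc_le_sum hE0 hF0 hb0 hw0 u (ltW Cgt0) qf qf0 qf1 kD.
have hQ := headtrunc_le_sum hE1 hF1 hb1 hw1 u0 (ltW Cgt0) qf qf0 qf1 kD.
set N0 := tailnorm E0 F0 b0 w0 _ in N0fin *.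
set N1 := headnorm E1 F1 b1 w1 _ in N1fin *.
have N00 : 0 <= N0 by exact: tnorm_ge0.
have N10 : 0 <= N1 by exact: tnorm_ge0.
have [n0 n00 n0E] := ge0_lty_real N00 N0fin.
have [n1 n10 n1E] := ge0_lty_real N10 N1fin.
have P0 : tailtrunc E0 F0 b0 w0 u (k f0) <= n0%:E.
  by rewrite -n0E; exact: (tailtrunc_le hE0 hF0 hb0 hw0 _ qf0).
have P1 : tailtrunc E0 F0 b0 w0 u (k f1) <= (C0 * r u * n1)%:E.
  by apply: (hC0 _ _ _ u0 n10 qf1); rewrite -n1E; exact: lexx.
have Q1 : headtrunc E1 F1 b1 w1 u (k f1) <= n1%:E.
  by rewrite -n1E; exact: (headtrunc_le hE1 hF1 hb1 hw1 u0 qf1).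
have Q0 : headtrunc E1 F1 b1 w1 u (k f0) <= (C1 * (r u)^-1 * n0)%:E.
  by rewrite invf_div; apply: (hC1 _ _ _ u0 n00 qf0); rewrite -n0E; exact: lexx.
apply: (@le_trans _ _ (C%:E * (n0%:E + (C0 * r u * n1)%:E) +
    (r u)%:E * (C%:E * ((C1 * (r u)^-1 * n0)%:E + n1%:E)))).
  apply: leeD.
    by apply: (le_trans hP); apply: lee_wpmul2l_fin; [exact: ltW|exact: leeD].
  apply: lee_wpmul2l_fin; first exact: ltW.
  by apply: (le_trans hQ); apply: lee_wpmul2l_fin; [exact: ltW|exact: leeD].
rewrite n0E n1E.
rewrite -[leLHS]/((C * (n0 + C0 * r u * n1) + r u * (C * (C1 * (r u)^-1 * n0 + n1)))%:E).
rewrite -[leRHS]/((D * (n0 + r u * n1))%:E) lee_fin.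
exact: num.
Qed.
End Holmstedt.

Lemma exists_small_exponent {R : realType} (x y z : R) : (0 < x)%R -> (0 < y)%R -> (0 < z)%R ->
  exists2 e : R, (0 < e)%R & [/\ 2 * e < x, 2 * e < y & 2 * e < z]%R.
Proof.
move=> x0 y0 z0; pose d := Num.min (Num.min x y) z.
have d0 : (0 < d)%R by rewrite !lt_min x0 y0 z0.
have [dx [dy dz]] : (d <= x)%R /\ (d <= y)%R /\ (d <= z)%R.
  by rewrite /d !ge_min !lexx ?orbT.
by exists (d / 4)%R; [rewrite divr_gt0|split; lra].
Qed.

Unset Implicit Arguments.

Theorem theorem3p3 (R : realType) (V : topologicalLmodType R)
    (X0 X1 : qspace R V) (hX : compatible_couple X0 X1)
    (th0 th1 : R) (hth0 : (0 < th0)%R) (hth01 : (th0 < th1)%R)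
    (hth1 : (th1 < 1)%R)
    (E0 E1 F0 F1 : fnorm R)
    (hE0 : ri_space E0) (hE1 : ri_space E1)
    (hF0 : ri_space F0) (hF1 : ri_space F1)
    (a0 a1 b0 b1 : R -> R)
    (ha0 : slowly_varying a0) (ha1 : slowly_varying a1)
    (hb0 : slowly_varying b0) (hb1 : slowly_varying b1)
    (hb0fin : tnorm E0 `]0%R, 1%R[%classic (EFin \o b0) < +oo)
    (hb1fin : tnorm E1 `]1%R, +oo[%classic (EFin \o b1) < +oo) :
  let YR := XR_space X0 X1 th0 b0 E0 a0 F0 in
  let YL := XL_space X0 X1 th1 b1 E1 a1 F1 in
  let r := rho th0 th1 a0 a1 b0 b1 E0 E1 in
  exists2 c : R, (0 < c)%R &
    forall f : V, sum_space YR YL f -> forall u : R, (0 < u)%R ->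
      equiv_with c (Kfun YR YL (r u) f)
        (tnorm E0 `]0%R, u[%classic
           (fun t => (b0 t)%:E *
              tnorm F0 `]t, u[%classic (wK X0 X1 th0 a0 f)) +
         (r u)%:E *
         tnorm E1 `]u, +oo[%classic
           (fun t => (b1 t)%:E *
              tnorm F1 `]u, t[%classic (wK X0 X1 th1 a1 f))).
Proof.
move=> YR YL r; have [_ hX0 hX1] := hX.
have th1_lt1 : (0 < 1 - th1)%R by rewrite subr_gt0.
have th01 : (0 < th1 - th0)%R by rewrite subr_gt0.
have [e e0 [eth0 eth1 eth]] := exists_small_exponent hth0 th1_lt1 th01.
have wa0 := weight_slowly_varying ha0 e0; have wa1 := weight_slowly_varying ha1 e0.
have wb0 := weight_slowly_varying hb0 e0; have wb1 := weight_slowly_varying hb1 e0.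
pose B0 u := fine (tnorm E0 `]0%R, u[%classic (EFin \o b0)).
pose B1 u := fine (tnorm E1 `]u, +oo[%classic (EFin \o b1)).
have B0E (u : R) : (0 < u)%R -> tnorm E0 `]0%R, u[%classic (EFin \o b0) = (B0 u)%:E.
  move=> u0; rewrite /B0.
  by have [v _ ->] := ge0_lty_real (tnorm_ge0 _ _ hE0) (initial_norm_fin hE0 wb0 ltr01 hb0fin u0).
have B1E (u : R) : (0 < u)%R -> tnorm E1 `]u, +oo[%classic (EFin \o b1) = (B1 u)%:E.
  move=> u0; rewrite /B1.
  by have [v _ ->] := ge0_lty_real (tnorm_ge0 _ _ hE1) (terminal_norm_fin hE1 wb1 ltr01 hb1fin u0).
have [C C0 hC] := Kfun_le_truncated hX0 hX1 hE0 hE1 hF0 hF1 wa0 wa1 wb0 wb1 e0 eth0 eth1 B0E B1E.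
have [D D0 hD] := truncated_le_Kfun hX0 hX1 hE0 hE1 hF0 hF1 wa0 wa1 wb0 wb1 eth B0E B1E.
have rE (u : R) : (0 < u)%R ->
    r u = ((u `^ (- th0) * a0 u * B0 u) / (u `^ (- th1) * a1 u * B1 u))%R.
  move=> u0; rewrite /r /rho -/(B0 u) -/(B1 u).
  rewrite powRD; last by rewrite gt_eqF.
  rewrite (powRN u th1) !invfM invrK; ring.
exists (C + D)%R => [|f Yf u u0]; first exact: addr_gt0.
have Sf : sum_space X0 X1 f.
  have [f0 [f1 [[Sf0 _] [Sf1 _] ->]]] := Yf; exact: (sum_spaceD hX0 hX1).
have ru0 : (0 < r u)%R.
  rewrite (rE _ u0); exact: (rho_weight_gt0 th0 th1 hE0 hE1 wa0 wa1 wb0 wb1 B0E B1E u0).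
rewrite (eq_nested_norm hX0 hX1 _ _ _ _ _ _ (fun t => `]t, u[%classic) Sf).
rewrite (eq_nested_norm hX0 hX1 _ _ _ _ _ _ (fun t => `]u, t[%classic) Sf).
have := hC _ _ Sf u0; have := hD _ _ Sf u0; rewrite -rE// => hD' hC'.
split.
  apply: (le_trans hC'); apply: lee_wpmul2r; last by rewrite lee_fin lerDl ltW.
  by apply: adde_ge0; [exact: tnorm_ge0|apply: mule_ge0; [rewrite lee_fin ltW|exact: tnorm_ge0]].
apply: (le_trans hD'); apply: lee_wpmul2r; last by rewrite lee_fin lerDr ltW.
apply/ereal_infP => _ [f0 [f1 [[Sf0 _] [Sf1 _] _ ->]]].
by apply: adde_ge0; [exact: tnorm_ge0|apply: mule_ge0; [rewrite lee_fin ltW|exact: tnorm_ge0]].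
Qed.
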